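(* Let $A$ be a Hopf $*$-algebra, $B$ a left $A$-comodule $*$-algebra and $(\Omega^\bullet,\wedge,d)$ an $A$-covariant $*$-differential calculus on $B$. If $(g,(\,,\,))$ is a real $A$-covariant metric on $\Omega^1$ and $\gamma$ is a unitary $2$-cocycle on $A$, then $$\mathscr H_{g_\gamma}=(\mathscr H_g)_\gamma .$$
   Context: Hopf algebras and modules. Algebras are unital over $\mathbb C$, $\otimes=\otimes_{\mathbb C}$, Hopf algebras $(A,\Delta,\epsilon,S)$ have bijective antipode. A Hopf $*$-algebra is a Hopf algebra that is a $*$-algebra with $\Delta$ a $*$-homomorphism. Sweedler notation: $\Delta(a)=a_{(1)}\otimes a_{(2)}$; left coactions are $v\mapsto v_{(-1)}\otimes v_{(0)}$, iterated as $v_{(-2)}\otimes v_{(-1)}\otimes v_{(0)}$. A left $A$-comodule $*$-algebra is a left $A$-comodule algebra $B$ that is a $*$-algebra whose coaction is a $*$-homomorphism. ${}^A_B\mathsf{Mod}_B$ is the category of $B$-bimodules with a left $A$-coaction satisfying $\delta(aeb)=\delta(a)\delta(e)\delta(b)$; morphisms are $A$-colinear $B$-bilinear maps; it is monoidal under $\otimes_B$. Cocycles. A $2$-cocycle on $A$ is a convolution-invertible linear $\gamma:A\otimes A\to\mathbb C$ (inverse $\bar\gamma$) with $\gamma(g_{(1)}\otimes h_{(1)})\gamma(g_{(2)}h_{(2)}\otimes k)=\gamma(h_{(1)}\otimes k_{(1)})\gamma(g\otimes h_{(2)}k_{(2)})$, always assumed unital: $\gamma(h\otimes1)=\epsilon(h)=\gamma(1\otimes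 h)$. It is unitary if $\overline{\gamma(a\otimes b)}=\bar\gamma(S(a)^*\otimes S(b)^* )$. Put $U(k)=\gamma(k_{(1)}\otimes S(k_{(2)}))$, $\bar U(k)=\bar\gamma(S(k_{(1)})\otimes k_{(2)})$, $V=U\circ S^{-1}$, $\bar V=\bar U\circ S^{-1}$, so $\bar V(k)=\bar\gamma(k_{(2)}\otimes S^{-1}(k_{(1)}))$. For unitary $\gamma$, $A_\gamma$ is the Hopf $*$-algebra with the coalgebra $A$, product $h\cdot_\gamma k=\gamma(h_{(1)}\otimes k_{(1)})h_{(2)}k_{(2)}\bar\gamma(h_{(3)}\otimes k_{(3)})$, antipode $S_\gamma(h)=U(h_{(1)})S(h_{(2)})\bar U(h_{(3)})$, involution $h^{*_\gamma}=\bar V(h_{(1)}^* )h_{(2)}^*V(h_{(3)}^* )$. $B_\gamma$ is the left $A_\gamma$-comodule $*$-algebra with underlying comodule $B$, $a\cdot_\gamma b=\gamma(a_{(-1)}\otimes b_{(-1)})a_{(0)}b_{(0)}$, $b^{*_\gamma}=\bar V(b_{(-1)}^* )b_{(0)}^*$. The functor $\Gamma:{}^A_B\mathsf{Mod}_B\to{}^{A_\gamma}_{B_\gamma}\mathsf{Mod}_{B_\gamma}$ is the identity on underlying comodules and maps, with actions $b\cdot_\gamma m=\gamma(b_{(-1)}\otimes m_{(-1)})b_{(0)}m_{(0)}$, $m\cdot_\gamma b=\gamma(m_{(-1)}\otimes b_{(-1)})m_{(0)}b_{(0)}$; it is monoidal via $\varphi_{V,W}:\Gamma(V)\otimes_{B_\gamma}\Gamma(W)\to\Gamma(V\otimes_BW)$,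 $v\otimes_{B_\gamma}w\mapsto\gamma(v_{(-1)}\otimes w_{(-1)})v_{(0)}\otimes_Bw_{(0)}$. Calculi. An $A$-covariant differential calculus over $B$ is a differential graded algebra $(\Omega^\bullet=\bigoplus_{k\ge0}\Omega^k,\wedge,d)$ with $\Omega^0=B$, generated as an algebra by $B$ and $dB$, such that the coaction of $B$ extends to a comodule algebra structure on $\Omega^\bullet$ with each $\Omega^k$ in ${}^A_B\mathsf{Mod}_B$ and $d$ $A$-colinear. It is an $A$-covariant $*$-differential calculus if the involution of $B$ extends to a conjugate-linear involution of $\Omega^\bullet$ preserving each $\Omega^k$, with $(d\omega)^*=d(\omega^* )$, $(\omega\wedge\nu)^*=(-1)^{kl}\nu^*\wedge\omega^*$ for $\omega\in\Omega^k,\nu\in\Omega^l$, compatible with the coaction. Its deformation $\Omega^k_\gamma=\Gamma(\Omega^k)$, $d_\gamma=\Gamma(d)$, $\omega\wedge_\gamma\eta=\gamma(\omega_{(-1)}\otimes\eta_{(-1)})\omega_{(0)}\wedge\eta_{(0)}$, $\omega^{*_\gamma}=\bar V(\omega_{(-1)}^* )\omega_{(0)}^*$ is an $A_\gamma$-covariant $*$-differential calculus on $B_\gamma$. Metrics. A metric on $\Omega^1$ is a pair $(g,(\,,\,))$, $g\in\Omega^1\otimes_B\Omega^1$, $(\,,\,):\Omega^1\otimes_B\Omega^1\to B$ $B$-bilinear, with $((\omega,\,)\otimes_B\mathrm{id})g=\omega=(\mathrm{id}\otimes_B(\,,\omega))g$. It is covariant if $(\,,\,)$ and $b\mapsto bg$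 are $A$-colinear; real if $g=\sum_i\omega_i\otimes_B\eta_i$ implies $g=\sum_i\eta_i^*\otimes_B\omega_i^*$. (If a metric exists, $\Omega^1$ is finitely generated projective as a left $B$-module.) Deformed metric: $g_\gamma=\varphi^{-1}_{\Omega^1,\Omega^1}(g)$, $(\,,\,)_\gamma=\Gamma((\,,\,))\circ\varphi_{\Omega^1,\Omega^1}$; for unitary $\gamma$ it is a real $A_\gamma$-covariant metric on $\Omega^1_\gamma$. Hermitian metrics. For $M$ in ${}^A_B\mathsf{Mod}_B$, $\overline M=\{\overline m:m\in M\}$ is the conjugate vector space with $b\overline m=\overline{mb^*}$, $\overline mb=\overline{b^*m}$, coaction $\overline m\mapsto m_{(-1)}^*\otimes\overline{m_{(0)}}$. ${}_B\mathrm{Hom}(\mathcal E,B)$ is the space of left $B$-linear maps, with $(bf)(e)=f(eb)$, $(fb)(e)=f(e)b$, coaction $f_{(-1)}\otimes f_{(0)}(e)=S(e_{(-1)})[f(e_{(0)})]_{(-1)}\otimes[f(e_{(0)})]_{(0)}$. An $A$-covariant Hermitian metric on $\mathcal E$ is an isomorphism $\mathscr H:\overline{\mathcal E}\to{}_B\mathrm{Hom}(\mathcal E,B)$ in ${}^A_B\mathsf{Mod}_B$ such that $\langle x,\overline y\rangle:=\mathscr H(\overline y)(x)$ satisfies $\langle y,\overline x\rangle^*=\langle x,\overline y\rangle$. A real covariant metric $(g,(\,,\,))$ on $\Omega^1$ gives the covariant Hermitian metric $\mathscr H_g(\overline\omega)(\eta)=(\eta,\omega^* )$; similarly $\mathscr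 H_{g_\gamma}(\overline\omega)(\eta)=(\eta,\omega^{*_\gamma})_\gamma$ on $\Omega^1_\gamma$. The $\gamma$-deformation of a covariant Hermitian metric $\mathscr H$ on $\mathcal E$ is $\mathscr H_\gamma=\mathfrak S\circ\Gamma(\mathscr H)\circ\mathfrak N_{\mathcal E}:\overline{\Gamma(\mathcal E)}\to{}_{B_\gamma}\mathrm{Hom}(\Gamma(\mathcal E),B_\gamma)$, where $\mathfrak S(f)(v)=\gamma\big(v_{(-2)}\otimes S(v_{(-1)})[f(v_{(0)})]_{(-1)}\big)[f(v_{(0)})]_{(0)}$ and $\mathfrak N_{\mathcal E}(\overline e)=\bar V(e_{(-1)}^* )\,\overline{e_{(0)}}\in\Gamma(\overline{\mathcal E})$. *)

(* Defs.v *)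
From HB Require Import structures.
From mathcomp Require Import all_boot all_order all_algebra.
From mathcomp Require Import boolp reals.
From mathcomp Require Export complex.

Set Implicit Arguments.
Unset Strict Implicit.
Unset Printing Implicit Defensive.

Import Order.TTheory GRing.Theory Num.Theory.

Local Open Scope ring_scope.
Local Open Scope quotient_scope.

Reserved Notation "v ⊗ w" (at level 40, left associativity).
Reserved Notation "a ∙ b" (at level 40, left associativity).
Reserved Notation "v ⊗b w" (at level 40, left associativity).
Reserved Notation "b ▷ m" (at level 40, left associativity).
Reserved Notation "m ◁ b" (at level 40, left associativity).
Reserved Notation "\sw_ ( a , b <- t ) F"
  (at level 36, F at level 36, a, b at level 50,
   format "'[' \sw_ ( a , b  <-  t ) '/  '  F ']'").

Definition lin (C : pzRingType) (V W : lmodType C) (f : V -> W) : Prop :=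
  forall c x y, f (c *: x + y) = c *: f x + f y.

(* [algType] of MathComp excludes the zero algebra, which is a legitimate
   comodule algebra; hence this variant without [1 != 0]. *)
Record algebra (C : pzRingType) := Algebra {
  alg_car :> lmodType C;
  aone : alg_car;
  amul : alg_car -> alg_car -> alg_car;
  amul_linl : forall b, lin (fun a => amul a b);
  amul_linr : forall a, lin (fun b => amul a b);
  amulA : associative amul;
  amul1l : left_id aone amul;
  amul1r : right_id aone amul
}.
Arguments aone {C _}.
Notation "a ∙ b" := (amul a b).

Record star_algebra (C : numClosedFieldType) := StarAlgebra {
  st_alg :> algebra C;
  star : st_alg -> st_alg;
  starD : {morph star : a b / a + b};
  starZ : forall (c : C) a, star (c *: a) = c^* *: star a;
  starM : forall a b, star (a ∙ b) = star b ∙ star a;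
  starK : involutive star
}.

(* Tensor products.  [tens r l] is the quotient of the formal finite sums of
   pairs (m, n) by the bilinearity relations over C and by
   (r k m, n) ~ (m, l k n) for k : K: with K empty it is the tensor product
   over C, with K := B acting on M on the right and on N on the left it is the
   tensor product over B. *)
Section Tensor.
Variables (C : numClosedFieldType) (M N : lmodType C) (K : Type).
Variables (r : K -> {linear M -> M}) (l : K -> {linear N -> N}).

Inductive tcong : seq (M * N) -> seq (M * N) -> Prop :=
| tc_refl s : tcong s s
| tc_sym s t : tcong s t -> tcong t s
| tc_trans s t u : tcong s t -> tcong t u -> tcong s u
| tc_cat s s' t t' : tcong s s' -> tcong t t' -> tcong (s ++ t) (s' ++ t')
| tc_comm s t : tcong (s ++ t) (t ++ s)
| tc_zero n : tcong [:: (0, n)] [::]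
| tc_addl m m' n : tcong [:: (m + m', n)] [:: (m, n); (m', n)]
| tc_addr m n n' : tcong [:: (m, n + n')] [:: (m, n); (m, n')]
| tc_scale c m n : tcong [:: (c *: m, n)] [:: (m, c *: n)]
| tc_bal k m n : tcong [:: (r k m, n)] [:: (m, l k n)].

Definition tcongb (s t : seq (M * N)) : bool := `[< tcong s t >].

Lemma tcongb_equiv : equiv_class_of tcongb.
Proof.
split.
- by move=> s; apply/asboolP/tc_refl.
- by move=> s t; apply/asboolP/asboolP; apply: tc_sym.
- by move=> s t u /asboolP st /asboolP tu; apply/asboolP/(tc_trans st tu).
Qed.

Canonical tcong_equiv := EquivRelPack tcongb_equiv.

Definition tens : Type := {eq_quot tcong_equiv}.
HB.instance Definition _ := Choice.on tens.
HB.instance Definition _ := EqQuotient.on tens.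

Definition tpi (s : seq (M * N)) : tens := \pi_({eq_quot tcong_equiv}) s.
Definition tpure (m : M) (n : N) : tens := tpi [:: (m, n)].

Lemma tpiP s t : tcong s t -> tpi s = tpi t.
Proof. by move=> st; apply/(eqmodP tcong_equiv)/asboolP. Qed.

Lemma tpi_repr t : tpi (repr t) = t.
Proof. exact: reprK. Qed.

Lemma repr_tpi s : tcong (repr (tpi s)) s.
Proof. by apply/asboolP/(eqmodP tcong_equiv); rewrite reprK. Qed.

(* Sweedler sums: [tlift t f], written \sw_(a, b <- t) f a b, is the image of t
   under the map m ⊗ n |-> f m n.  This is meaningful (independent of the chosen
   presentation of t) when f is [balanced], see [tlift_pi] and [tlift_pure].
   Conjugate-linear f, as in m ⊗ n |-> m^* ⊗ n^*, are balanced too. *)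
Definition tlift (Z : nmodType) (t : tens) (f : M -> N -> Z) : Z :=
  \sum_(p <- repr t) f p.1 p.2.
Arguments tlift {Z} t f.

Record balanced (Z : zmodType) (f : M -> N -> Z) : Prop := Balanced {
  balDl : forall m m' n, f (m + m') n = f m n + f m' n;
  balDr : forall m n n', f m (n + n') = f m n + f m n';
  balZ : forall c m n, f (c *: m) n = f m (c *: n);
  balK : forall k m n, f (r k m) n = f m (l k n)
}.

Lemma tcong_sum (Z : zmodType) (f : M -> N -> Z) s t : balanced f -> tcong s t ->
  \sum_(p <- s) f p.1 p.2 = \sum_(p <- t) f p.1 p.2.
Proof.
move=> [Dl Dr Z0 K0]; elim=> //=.
- by move=> s1 t1 u1 _ -> _ ->.
- by move=> s1 s2 t1 t2 _ IH1 _ IH2; rewrite !big_cat /= IH1 IH2.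
- by move=> s1 t1; rewrite !big_cat /= addrC.
- move=> n; rewrite big_seq1 big_nil /=.
  by apply: (addIr (f 0 n)); rewrite -Dl !add0r.
- by move=> m m' n; rewrite !big_cons !big_nil /= !addr0 Dl.
- by move=> m n n'; rewrite !big_cons !big_nil /= !addr0 Dr.
- by move=> c m n; rewrite !big_seq1 /= Z0.
- by move=> k m n; rewrite !big_seq1 /= K0.
Qed.

Lemma tlift_pi (Z : zmodType) (f : M -> N -> Z) s : balanced f ->
  tlift (tpi s) f = \sum_(p <- s) f p.1 p.2.
Proof. by move=> fb; apply: tcong_sum => //; apply: repr_tpi. Qed.

Lemma tlift_pure (Z : zmodType) (f : M -> N -> Z) m n : balanced f ->
  tlift (tpure m n) f = f m n.
Proof. by move=> fb; rewrite tlift_pi // big_seq1. Qed.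

Definition tzero : tens := tpi [::].
Definition tadd (x y : tens) : tens := tpi (repr x ++ repr y).
Definition topp (x : tens) : tens := tpi [seq (- p.1, p.2) | p <- repr x].
Definition tscale (c : C) (x : tens) : tens := tpi [seq (c *: p.1, p.2) | p <- repr x].

Lemma taddE s t : tadd (tpi s) (tpi t) = tpi (s ++ t).
Proof. by apply: tpiP; apply: tc_cat; apply: repr_tpi. Qed.

Lemma tcong_map (g : {linear M -> M}) :
  (forall k m, g (r k m) = r k (g m)) ->
  forall s t, tcong s t ->
  tcong [seq (g p.1, p.2) | p <- s] [seq (g p.1, p.2) | p <- t].
Proof.
move=> gr s t; elim=> /=.
- by move=> ?; apply: tc_refl.
- by move=> ? ? _; apply: tc_sym.
- by move=> s1 t1 u1 _ st _; apply: tc_trans.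
- by move=> *; rewrite !map_cat; apply: tc_cat.
- by move=> *; rewrite !map_cat; apply: tc_comm.
- by move=> n; rewrite linear0; apply: tc_zero.
- by move=> m m' n; rewrite linearD; apply: tc_addl.
- by move=> *; apply: tc_addr.
- by move=> *; rewrite linearZ; apply: tc_scale.
- by move=> *; rewrite gr; apply: tc_bal.
Qed.

Lemma tmapE (g : {linear M -> M}) : (forall k m, g (r k m) = r k (g m)) ->
  forall s, tpi [seq (g p.1, p.2) | p <- repr (tpi s)] =
            tpi [seq (g p.1, p.2) | p <- s].
Proof. by move=> gr s; apply/tpiP/tcong_map => //; apply: repr_tpi. Qed.

Lemma toppE s : topp (tpi s) = tpi [seq (- p.1, p.2) | p <- s].
Proof. by apply: (tmapE (g := -%R)) => k m; rewrite /= linearN. Qed.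

Lemma tscaleE c s : tscale c (tpi s) = tpi [seq (c *: p.1, p.2) | p <- s].
Proof. by apply: (tmapE (g := *:%R c)) => k m; rewrite /= linearZ. Qed.

Lemma taddA : associative tadd.
Proof.
move=> x y z; rewrite -[x]tpi_repr -[y]tpi_repr -[z]tpi_repr.
by rewrite !taddE catA.
Qed.

Lemma taddC : commutative tadd.
Proof. by move=> x y; apply: tpiP; apply: tc_comm. Qed.

Lemma tadd0 : left_id tzero tadd.
Proof. by move=> x; rewrite -[x]tpi_repr taddE. Qed.

Lemma taddN : left_inverse tzero topp tadd.
Proof.
move=> x; rewrite -[x]tpi_repr toppE taddE; apply: tpiP.
elim: (repr x) => [|[m n] s IH] /=; first exact: tc_refl.
rewrite -cat1s -[(m, n) :: s]cat1s.
have -> : [:: (- m, n)] ++ [seq (- p.1, p.2) | p <- s] ++ [:: (m, n)] ++ s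
        = ([:: (- m, n)] ++ ([seq (- p.1, p.2) | p <- s] ++ [:: (m, n)])) ++ s.
  by rewrite !catA.
apply: (@tc_trans _ (([:: (- m, n)] ++ ([:: (m, n)] ++ [seq (- p.1, p.2) | p <- s])) ++ s)).
  apply: tc_cat; last exact: tc_refl.
  by apply: tc_cat; [exact: tc_refl|exact: tc_comm].
rewrite -!catA catA -[X in tcong _ X]cat0s; apply: tc_cat => //.
apply: tc_trans (tc_zero n); rewrite -(addNr m) /=.
exact/tc_sym/tc_addl.
Qed.

HB.instance Definition _ := GRing.isZmodule.Build tens taddA taddC tadd0 taddN.

Lemma tscaleA a b v : tscale a (tscale b v) = tscale (a * b) v.
Proof.
rewrite -[v]tpi_repr !tscaleE -map_comp; congr tpi.
by apply: eq_map => p /=; rewrite scalerA.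
Qed.

Lemma tscale1 : left_id 1 tscale.
Proof.
move=> v; rewrite -[v]tpi_repr !tscaleE; congr tpi.
by rewrite -[RHS]map_id; apply: eq_map => -[m n] /=; rewrite scale1r.
Qed.

Lemma tscaleDr : right_distributive tscale +%R.
Proof.
move=> a x y; rewrite -[x]tpi_repr -[y]tpi_repr /GRing.add /=.
by rewrite taddE !tscaleE map_cat taddE.
Qed.

Lemma tscaleDl v : {morph tscale^~ v : a b / a + b}.
Proof.
move=> a b; rewrite -[v]tpi_repr [RHS]/GRing.add /= !tscaleE taddE; apply: tpiP.
elim: (repr v) => [|[m n] s IH] /=; first exact: tc_refl.
apply: (@tc_trans _ ([:: (a *: m, n); (b *: m, n)] ++
     ([seq (a *: p.1, p.2) | p <- s] ++ [seq (b *: p.1, p.2) | p <- s]))).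
  rewrite -cat1s; apply: tc_cat => //.
  by rewrite scalerDl; apply: tc_addl.
rewrite /= -[_ :: _]cat1s -[X in tcong _ X]cat1s; apply: tc_cat; first exact: tc_refl.
rewrite -cat1s catA.
rewrite -[X in tcong _ (_ ++ X)]cat1s [X in tcong _ X]catA.
by apply: tc_cat; [exact: tc_comm|exact: tc_refl].
Qed.

HB.instance Definition _ := GRing.Zmodule_isLmodule.Build C tens
  tscaleA tscale1 tscaleDr tscaleDl.

Lemma tpureDl m m' n : tpure (m + m') n = tpure m n + tpure m' n.
Proof. by rewrite {1}/GRing.add /= [RHS]taddE; apply/tpiP/tc_addl. Qed.
Lemma tpureDr m n n' : tpure m (n + n') = tpure m n + tpure m n'.
Proof. by rewrite [RHS]taddE; apply/tpiP/tc_addr. Qed.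
Lemma tpureZl c m n : tpure (c *: m) n = c *: tpure m n.
Proof. by rewrite [RHS]tscaleE. Qed.
Lemma tpureZ c m n : tpure (c *: m) n = tpure m (c *: n).
Proof. exact/tpiP/tc_scale. Qed.
Lemma tpureZr c m n : tpure m (c *: n) = c *: tpure m n.
Proof. by rewrite -tpureZ tpureZl. Qed.
Lemma tpureK k m n : tpure (r k m) n = tpure m (l k n).
Proof. exact/tpiP/tc_bal. Qed.

Lemma tpi_sum s : tpi s = \sum_(p <- s) tpure p.1 p.2.
Proof.
elim: s => [|[m n] s IH]; first by rewrite big_nil.
by rewrite big_cons -IH /= [RHS]taddE.
Qed.

Lemma tens_sum t : t = \sum_(p <- repr t) tpure p.1 p.2.
Proof. by rewrite -tpi_sum tpi_repr. Qed.

Lemma tlift_id t : tlift t tpure = t.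
Proof. by rewrite [RHS]tens_sum. Qed.

Lemma tliftD (Z : zmodType) (f : M -> N -> Z) (fb : balanced f) :
  {morph (fun t => tlift t f) : x y / x + y}.
Proof.
move=> x y; rewrite -[x]tpi_repr -[y]tpi_repr [in LHS]/GRing.add /= taddE.
by rewrite !tlift_pi // big_cat.
Qed.

Lemma tlift0 (Z : zmodType) (f : M -> N -> Z) (fb : balanced f) : tlift 0 f = 0.
Proof. by rewrite tlift_pi // big_nil. Qed.

Lemma tlift_sum (Z : zmodType) (f : M -> N -> Z) (fb : balanced f)
    (I : Type) (s : seq I) (F : I -> tens) :
  tlift (\sum_(i <- s) F i) f = \sum_(i <- s) tlift (F i) f.
Proof.
elim: s => [|i s IH]; first by rewrite !big_nil tlift0.
by rewrite !big_cons tliftD // IH.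
Qed.

End Tensor.
Arguments tlift {C M N K r l Z} t f.

Notation "\sw_ ( a , b <- t ) F" := (tlift t (fun a b => F)) : ring_scope.

Definition no_ops (C : numClosedFieldType) (V : lmodType C) (k : void) :
  {linear V -> V} := of_void _ k.

Section TensorC.
Variables (C : numClosedFieldType) (V W : lmodType C).

Definition tensC : lmodType C := tens (@no_ops C V) (@no_ops C W).
Definition tpureC (v : V) (w : W) : tensC := tpure (@no_ops C V) (@no_ops C W) v w.

End TensorC.
Notation "v ⊗ w" := (tpureC v w) : ring_scope.

Record hopf_star_algebra (C : numClosedFieldType) := HopfStarAlgebra {
  hopf_alg :> star_algebra C;
  Delta : {linear hopf_alg -> tensC hopf_alg hopf_alg};
  eps : {scalar hopf_alg};
  antip : {linear hopf_alg -> hopf_alg};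
  antip_inv : hopf_alg -> hopf_alg;
  DeltaA : forall a,
    \sw_(a1, a2 <- Delta a) (a1 ⊗ Delta a2) =
    \sw_(a1, a3 <- Delta a) \sw_(a11, a12 <- Delta a1) (a11 ⊗ (a12 ⊗ a3));
  Delta1l : forall a, \sw_(a1, a2 <- Delta a) (eps a1 *: a2) = a;
  Delta1r : forall a, \sw_(a1, a2 <- Delta a) (eps a2 *: a1) = a;
  Delta_one : Delta aone = aone ⊗ aone;
  Delta_mul : forall a b, Delta (a ∙ b) =
    \sw_(a1, a2 <- Delta a) \sw_(b1, b2 <- Delta b) ((a1 ∙ b1) ⊗ (a2 ∙ b2));
  eps_one : eps aone = 1;
  eps_mul : forall a b, eps (a ∙ b) = eps a * eps b;
  antipl : forall a, \sw_(a1, a2 <- Delta a) (antip a1 ∙ a2) = eps a *: aone;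
  antipr : forall a, \sw_(a1, a2 <- Delta a) (a1 ∙ antip a2) = eps a *: aone;
  antipK : cancel antip antip_inv;
  antip_invK : cancel antip_inv antip;
  Delta_star : forall a,
    Delta (star a) = \sw_(a1, a2 <- Delta a) (star a1 ⊗ star a2)
}.
Arguments Delta {C _}.
Arguments eps {C _}.
Arguments antip {C _}.

Section Covariant.
Variables (C : numClosedFieldType) (A : hopf_star_algebra C).

Record is_coaction (V : lmodType C) (delta : {linear V -> tensC A V}) : Prop :=
  IsCoaction {
    coactA : forall v,
      \sw_(a, v0 <- delta v) (a ⊗ delta v0) =
      \sw_(a, v0 <- delta v) \sw_(a1, a2 <- Delta a) (a1 ⊗ (a2 ⊗ v0));
    coact1 : forall v, \sw_(a, v0 <- delta v) (eps a *: v0) = v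
  }.

Record comodule_star_algebra := ComoduleStarAlgebra {
  csa_alg :> star_algebra C;
  csa_coact : {linear csa_alg -> tensC A csa_alg};
  csa_coactP : is_coaction csa_coact;
  csa_coact_one : csa_coact aone = aone ⊗ aone;
  csa_coact_mul : forall b c, csa_coact (b ∙ c) =
    \sw_(b1, b0 <- csa_coact b) \sw_(c1, c0 <- csa_coact c)
      ((b1 ∙ c1) ⊗ (b0 ∙ c0));
  csa_coact_star : forall b, csa_coact (star b) =
    \sw_(b1, b0 <- csa_coact b) (star b1 ⊗ star b0)
}.

End Covariant.
Arguments csa_coact {C A _}.

Record bimodule (C : numClosedFieldType) (B : algebra C) := Bimodule {
  bim_car :> lmodType C;
  lact : B -> {linear bim_car -> bim_car};
  ract : B -> {linear bim_car -> bim_car};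
  lact_lin : forall m, lin (fun b => lact b m);
  ract_lin : forall m, lin (fun b => ract b m);
  lact1 : forall m, lact aone m = m;
  ract1 : forall m, ract aone m = m;
  lactM : forall a b m, lact (a ∙ b) m = lact a (lact b m);
  ractM : forall a b m, ract (a ∙ b) m = ract b (ract a m);
  lractA : forall a b m, ract b (lact a m) = lact a (ract b m)
}.
Arguments lact {C B _}.
Arguments ract {C B _}.
Notation "b ▷ m" := (lact b m) : ring_scope.
Notation "m ◁ b" := (ract b m) : ring_scope.

Record bimodule_hom (C : numClosedFieldType) (B : algebra C)
    (E F : bimodule B) := BimoduleHom {
  bh_fun :> {linear E -> F};
  bh_lact : forall b e, bh_fun (b ▷ e) = b ▷ bh_fun e;
  bh_ract : forall b e, bh_fun (e ◁ b) = bh_fun e ◁ b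
}.

Section Lin.
Variable (C : numClosedFieldType).
Implicit Types V W Z : lmodType C.

Lemma lin_id V : lin (fun x : V => x). Proof. by []. Qed.
Lemma lin_linear V W Z (g : {linear W -> Z}) (f : V -> W) :
  lin f -> lin (fun x => g (f x)).
Proof. by move=> fl c x y; rewrite fl linearP. Qed.
Lemma lin_lin V W Z (g : W -> Z) (f : V -> W) : lin g ->
  lin f -> lin (fun x => g (f x)).
Proof. by move=> gl fl c x y; rewrite fl gl. Qed.
Lemma lin_scale V W (f : V -> W) c : lin f -> lin (fun x => c *: f x).
Proof. by move=> fl d x y; rewrite fl scalerDr !scalerA mulrC. Qed.
Lemma lin_scalel V W (f : V -> C^o) (w : W) : lin f -> lin (fun x => f x *: w).
Proof. by move=> fl d x y; rewrite fl scalerDl -scalerA. Qed.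
Lemma lin_form V W (g : {scalar W}) (f : V -> W) :
  lin f -> lin (fun x => g (f x) : C^o).
Proof. by move=> fl c x y; rewrite fl linearP. Qed.
Lemma lin_mulC V (f : V -> C^o) c : lin f -> lin (fun x => f x * c : C^o).
Proof. by move=> fl d x y; rewrite fl mulrDl -[d *: _ * _]mulrA. Qed.
Lemma lin_mulCr V (f : V -> C^o) c : lin f -> lin (fun x => c * f x : C^o).
Proof. move=> fl d x y; rewrite fl mulrDr; congr (_ + _); exact: mulrCA. Qed.
Lemma lin_sum V W I (s : seq I) (F : I -> V -> W) :
  (forall i, lin (F i)) -> lin (fun x => \sum_(i <- s) F i x).
Proof.
move=> Fl c x y; rewrite scaler_sumr -big_split /=.
by apply: eq_bigr => i _; rewrite Fl.
Qed.
Lemma lin_mull V (A : algebra C) (f : V -> A) a : lin f -> lin (fun x => f x ∙ a).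
Proof. by move=> fl c x y; rewrite fl amul_linl. Qed.
Lemma lin_mulr V (A : algebra C) (f : V -> A) a : lin f -> lin (fun x => a ∙ f x).
Proof. by move=> fl c x y; rewrite fl amul_linr. Qed.
Lemma lin_lact V (B : algebra C) (E : bimodule B) (f : V -> B) (e : E) :
  lin f -> lin (fun x => f x ▷ e).
Proof. by move=> fl c x y; rewrite fl lact_lin. Qed.
Lemma lin_ract V (B : algebra C) (E : bimodule B) (f : V -> B) (e : E) :
  lin f -> lin (fun x => e ◁ f x).
Proof. by move=> fl c x y; rewrite fl ract_lin. Qed.
Lemma lin_pureCl V W Z (f : V -> W) (z : Z) : lin f -> lin (fun x => f x ⊗ z).
Proof. by move=> fl c x y; rewrite fl /tpureC tpureDl tpureZl. Qed.
Lemma lin_pureCr V W Z (f : V -> Z) (w : W) : lin f -> lin (fun x => w ⊗ f x).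
Proof. by move=> fl c x y; rewrite fl /tpureC tpureDr tpureZr. Qed.

Lemma linD V W (f : V -> W) : lin f -> {morph f : x y / x + y}.
Proof. by move=> fl x y; rewrite -[x]scale1r fl !scale1r. Qed.
Lemma lin0 V W (f : V -> W) : lin f -> f 0 = 0.
Proof. by move=> fl; apply: (addIr (f 0)); rewrite -(linD fl) !add0r. Qed.
Lemma linZ V W (f : V -> W) : lin f -> forall c x, f (c *: x) = c *: f x.
Proof. by move=> fl c x; rewrite -[c *: x]addr0 fl (lin0 fl) addr0. Qed.
Lemma lin_bigsum V W (f : V -> W) I (s : seq I) (F : I -> V) : lin f ->
  f (\sum_(i <- s) F i) = \sum_(i <- s) f (F i).
Proof. move=> fl; exact: (big_morph f (linD fl) (lin0 fl)). Qed.

Record bilin V W Z (f : V -> W -> Z) : Prop := Bilin {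
  bilinl : forall w, lin (f^~ w);
  bilinr : forall v, lin (f v)
}.

Lemma bilin_balanced V W Z (f : V -> W -> Z) : bilin f ->
  balanced (@no_ops C V) (@no_ops C W) f.
Proof.
move=> [fl fr]; split=> [m m' n|m n n'|c m n|[]].
- exact: (linD (fl n)).
- exact: (linD (fr m)).
- by rewrite (linZ (fl n)) (linZ (fr m)).
Qed.

Lemma sw_pure V W Z (f : V -> W -> Z) v w : bilin f -> tlift (v ⊗ w) f = f v w.
Proof. by move=> fb; apply/tlift_pure/bilin_balanced. Qed.
Lemma sw_sum V W Z (f : V -> W -> Z) I (s : seq I) (F : I -> tensC V W) : bilin f ->
  tlift (\sum_(i <- s) F i) f = \sum_(i <- s) tlift (F i) f.
Proof. by move=> fb; apply/tlift_sum/bilin_balanced. Qed.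

Lemma tlift_lin V W K (r : K -> {linear V -> V}) (l : K -> {linear W -> W}) Z
    (f : V -> W -> Z) : balanced r l f -> (forall w, lin (f^~ w)) ->
  lin (fun t : tens r l => tlift t f).
Proof.
move=> fb fl c x y; rewrite (tliftD fb); congr (_ + _).
rewrite {1}[x]tens_sum scaler_sumr (tlift_sum fb) [in RHS]/tlift scaler_sumr.
by apply: eq_bigr => p _; rewrite -tpureZl (tlift_pure _ _ fb) (linZ (fl _)).
Qed.
Lemma sw_lin V W Z (f : V -> W -> Z) : bilin f -> lin (fun t : tensC V W => tlift t f).
Proof.
by move=> fb; apply: tlift_lin; [exact: bilin_balanced|exact: bilinl].
Qed.
Lemma lin_sw V W W' Z (f : V -> tensC W W') (g : W -> W' -> Z) : bilin g ->
  lin f -> lin (fun x => tlift (f x) g).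
Proof. by move=> gb fl; apply: (lin_lin (sw_lin gb)). Qed.
Lemma lin_swf V W W' K (r : K -> {linear W -> W}) (l : K -> {linear W' -> W'}) Z
   (g : V -> W -> W' -> Z) (t : tens r l) :
  (forall a b, lin (fun x => g x a b)) -> lin (fun x => tlift t (g x)).
Proof. by move=> gl; apply: lin_sum => p; apply: gl. Qed.

End Lin.


Section LinTens.
Variables (C : numClosedFieldType) (V M N : lmodType C) (K : Type).
Variables (r : K -> {linear M -> M}) (l : K -> {linear N -> N}).

Lemma lin_tpurel (f : V -> M) n : lin f -> lin (fun x => tpure r l (f x) n).
Proof. by move=> fl c x y; rewrite fl tpureDl tpureZl. Qed.
Lemma lin_tpurer (f : V -> N) m : lin f -> lin (fun x => tpure r l m (f x)).
Proof. by move=> fl c x y; rewrite fl tpureDr tpureZr. Qed.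

Lemma bilin_bal (Z : lmodType C) (f : M -> N -> Z) : bilin f ->
  (forall k m n, f (r k m) n = f m (l k n)) -> balanced r l f.
Proof.
move=> [fl fr]; split=> // [m m' n|m n n'|c m n].
- exact: (linD (fl n)).
- exact: (linD (fr m)).
- by rewrite (linZ (fl n)) (linZ (fr m)).
Qed.

Lemma tens_ext (Z : lmodType C) (f g : tens r l -> Z) : lin f -> lin g ->
  (forall m n, f (tpure r l m n) = g (tpure r l m n)) -> f =1 g.
Proof.
move=> fl gl fg t; rewrite [t]tens_sum (lin_bigsum _ _ fl) (lin_bigsum _ _ gl).
by apply: eq_bigr => p _.
Qed.

End LinTens.

Section LinBil.
Variables (C : numClosedFieldType) (T U V Z : lmodType C) (m : U -> V -> Z).
Hypothesis mb : bilin m.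
Lemma lin_bil1 (f : T -> U) v : lin f -> lin (fun x => m (f x) v).
Proof. by move=> fl c x y; rewrite fl (bilinl mb v). Qed.
Lemma lin_bil2 (f : T -> V) u : lin f -> lin (fun x => m u (f x)).
Proof. by move=> fl c x y; rewrite fl (bilinr mb u). Qed.
End LinBil.

Ltac linq := repeat first
  [ assumption | apply: lin_id
  | match goal with H : bilin _ |- _ =>
      first [apply: (lin_bil1 H) | apply: (lin_bil2 H)] end | (split=> ? /=)
  | apply: lin_scalel | apply: lin_scale | apply: lin_form | apply: lin_mulC | apply: lin_mulCr
  | apply: lin_mull | apply: lin_mulr
  | apply: lin_lact | apply: lin_ract | apply: lin_pureCl | apply: lin_pureCr
  | apply: lin_tpurel | apply: lin_tpurer
  | (apply: lin_swf => ? ?) | apply: lin_sw | apply: lin_linear ].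

Section Sw.
Variable C : numClosedFieldType.

Lemma eq_sw (M N : lmodType C) K (r : K -> {linear M -> M})
    (l : K -> {linear N -> N}) (Z : nmodType) (t : tens r l) (f g : M -> N -> Z) :
  (forall a b, f a b = g a b) -> tlift t f = tlift t g.
Proof. by move=> fg; apply: eq_bigr => p _. Qed.

Lemma sw_exch (M N M' N' : lmodType C) K (r : K -> {linear M -> M})
    (l : K -> {linear N -> N}) K' (r' : K' -> {linear M' -> M'})
    (l' : K' -> {linear N' -> N'})
    (Z : nmodType) (s : tens r l) (t : tens r' l') (f : M -> N -> M' -> N' -> Z) :
  \sw_(a, b <- s) \sw_(c, d <- t) f a b c d =
  \sw_(c, d <- t) \sw_(a, b <- s) f a b c d.
Proof. exact: exchange_big. Qed.

Lemma lin_sw_out (V W : lmodType C) (M N : lmodType C) K (r : K -> {linear M -> M})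
    (l : K -> {linear N -> N}) (t : tens r l) (f : M -> N -> V) (g : V -> W) :
  lin g -> g (tlift t f) = \sw_(a, b <- t) g (f a b).
Proof. exact: lin_bigsum. Qed.

Lemma sw_sw (V W Z : lmodType C) (M N : lmodType C) K (r : K -> {linear M -> M})
    (l : K -> {linear N -> N}) (t : tens r l) (F : M -> N -> tensC V W)
    (G : V -> W -> Z) : bilin G ->
  tlift (tlift t F) G = \sw_(a, b <- t) tlift (F a b) G.
Proof. by move=> Gb; apply: sw_sum. Qed.

Lemma sw_scale (V : lmodType C) (M N : lmodType C) K (r : K -> {linear M -> M})
    (l : K -> {linear N -> N}) (t : tens r l) (F : M -> N -> V) c :
  c *: tlift t F = \sw_(a, b <- t) (c *: F a b).
Proof. exact: scaler_sumr. Qed.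

Lemma sw_scalel (V : lmodType C) (M N : lmodType C) K (r : K -> {linear M -> M})
    (l : K -> {linear N -> N}) (t : tens r l) (F : M -> N -> C) (v : V) :
  tlift t F *: v = \sw_(a, b <- t) (F a b *: v).
Proof. exact: scaler_suml. Qed.

Lemma swD (M N : lmodType C) K (r : K -> {linear M -> M})
    (l : K -> {linear N -> N}) (Z : nmodType) (t : tens r l) (f g : M -> N -> Z) :
  tlift t f + tlift t g = \sw_(a, b <- t) (f a b + g a b).
Proof. by rewrite /tlift big_split. Qed.

End Sw.

Section CoactTheory.
Variables (C : numClosedFieldType) (A : hopf_star_algebra C).

Record trilin (U V W Z : lmodType C) (f : U -> V -> W -> Z) : Prop := Trilin {
  tril1 : forall v w, lin (fun u => f u v w);
  tril2 : forall u w, lin (fun v => f u v w);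
  tril3 : forall u v, lin (fun w => f u v w)
}.

Lemma coact_swap (V Z : lmodType C) (delta : {linear V -> tensC A V})
    (f : A -> A -> V -> Z) v : is_coaction delta -> trilin f ->
  \sw_(a, v0 <- delta v) \sw_(b, w <- delta v0) f a b w =
  \sw_(a, v0 <- delta v) \sw_(a1, a2 <- Delta a) f a1 a2 v0.
Proof.
move=> [dA _] [f1 f2 f3].
have fb a : bilin (f a) by split=> ?; [apply: f2|apply: f3].
pose G (a : A) (t : tensC A V) := \sw_(b, w <- t) f a b w.
have Gb : bilin G.
  split=> ?; rewrite /G; last exact: sw_lin.
  by apply: lin_swf => b w; apply: f1.
have := congr1 (fun T => tlift T G) (dA v).
rewrite !(sw_sw _ _ Gb); under eq_sw do rewrite (sw_pure _ _ Gb).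
move=> ->; apply: eq_sw => a v0; rewrite (sw_sw _ _ Gb); apply: eq_sw => b w.
by rewrite (sw_pure _ _ Gb) /G (sw_pure _ _ (fb _)).
Qed.

Lemma coact_counit (V Z : lmodType C) (delta : {linear V -> tensC A V})
    (f : V -> Z) v : is_coaction delta -> lin f ->
  \sw_(a, v0 <- delta v) (eps a *: f v0) = f v.
Proof.
move=> [_ d1] fl; rewrite -[in RHS](d1 v) (lin_sw_out _ _ fl).
by apply: eq_sw => a v0; rewrite (linZ fl).
Qed.

Lemma Delta_coaction : is_coaction (@Delta C A).
Proof. by split; [exact: DeltaA|exact: Delta1l]. Qed.

Lemma coact_swap2 (U V Z : lmodType C) (dU : {linear U -> tensC A U})
    (dV : {linear V -> tensC A V}) (f : A -> A -> U -> A -> A -> V -> Z) u v :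
  is_coaction dU -> is_coaction dV ->
  (forall b1 b2 v, trilin (fun a1 a2 u => f a1 a2 u b1 b2 v)) ->
  (forall a1 a2 u, trilin (f a1 a2 u)) ->
  \sw_(a, u0 <- dU u) \sw_(b, v0 <- dV v)
    \sw_(a', u00 <- dU u0) \sw_(b', v00 <- dV v0) f a a' u00 b b' v00 =
  \sw_(a, u0 <- dU u) \sw_(b, v0 <- dV v)
    \sw_(a1, a2 <- Delta a) \sw_(b1, b2 <- Delta b) f a1 a2 u0 b1 b2 v0.
Proof.
move=> hU hV fU fV.
under eq_sw => a u0 do rewrite sw_exch.
transitivity (\sw_(a, u0 <- dU u) \sw_(a', u00 <- dU u0)
    \sw_(b, v0 <- dV v) \sw_(b1, b2 <- Delta b) f a a' u00 b1 b2 v0).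
  by apply: eq_sw => a u0; apply: eq_sw => a' u00; apply: coact_swap.
rewrite coact_swap //; first by apply: eq_sw => a u0; rewrite sw_exch.
by split=> ? ?; apply: lin_swf => ? ?; apply: lin_swf => ? ?;
   [exact: (tril1 (fU _ _ _))|exact: (tril2 (fU _ _ _))|exact: (tril3 (fU _ _ _))].
Qed.

End CoactTheory.

Section Cocycle.
Variables (C : numClosedFieldType) (A : hopf_star_algebra C).

Record cocycle := Cocycle {
  gam : {scalar tensC A A};
  gam_inv : {scalar tensC A A};
  gam_invr : forall a b,
    \sw_(a1, a2 <- Delta a) \sw_(b1, b2 <- Delta b)
      (gam (a1 ⊗ b1) * gam_inv (a2 ⊗ b2)) = eps a * eps b;
  gam_invl : forall a b,
    \sw_(a1, a2 <- Delta a) \sw_(b1, b2 <- Delta b)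
      (gam_inv (a1 ⊗ b1) * gam (a2 ⊗ b2)) = eps a * eps b;
  gam_cocycle : forall g h k,
    \sw_(g1, g2 <- Delta g) \sw_(h1, h2 <- Delta h)
      (gam (g1 ⊗ h1) * gam ((g2 ∙ h2) ⊗ k)) =
    \sw_(h1, h2 <- Delta h) \sw_(k1, k2 <- Delta k)
      (gam (h1 ⊗ k1) * gam (g ⊗ (h2 ∙ k2)));
  gam_unitr : forall h, gam (h ⊗ aone) = eps h;
  gam_unitl : forall h, gam (aone ⊗ h) = eps h
}.

Definition unitary (g : cocycle) : Prop := forall a b : A,
  (gam g (a ⊗ b))^* = gam_inv g (star (antip a) ⊗ star (antip b)).

Variable g : cocycle.

Definition Ubar (k : A) : C :=
  \sw_(k1, k2 <- Delta k) gam_inv g (antip k1 ⊗ k2).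
Definition Vbar (k : A) : C := Ubar (antip_inv k).

(* m twisted by γ: u ⊗ v |-> γ(u_(-1) ⊗ v_(-1)) m(u_(0), v_(0)); every deformed
   product, action and pairing below, and φ itself, is of this form. *)
Definition tw (U V Z : lmodType C) (dU : U -> tensC A U) (dV : V -> tensC A V)
    (m : U -> V -> Z) (u : U) (v : V) : Z :=
  \sw_(a, u0 <- dU u) \sw_(b, v0 <- dV v) (gam g (a ⊗ b) *: m u0 v0).

Definition colinear2 (U V Z : lmodType C) (dU : U -> tensC A U)
    (dV : V -> tensC A V) (dZ : Z -> tensC A Z) (m : U -> V -> Z) : Prop :=
  forall u v, dZ (m u v) =
    \sw_(a, u0 <- dU u) \sw_(b, v0 <- dV v) ((a ∙ b) ⊗ m u0 v0).

Lemma tw_bilin (U V Z : lmodType C) (dU : {linear U -> tensC A U})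
    (dV : {linear V -> tensC A V}) (m : U -> V -> Z) :
  bilin m -> bilin (tw dU dV m).
Proof.
move=> mb; split=> ?; rewrite /tw; linq.
Qed.

Section Tw.
Variables U V W X Y Z : lmodType C.
Variables (dU : {linear U -> tensC A U}) (dV : {linear V -> tensC A V}).
Variables (dW : {linear W -> tensC A W}).
Variables (dX : {linear X -> tensC A X}) (dY : {linear Y -> tensC A Y}).
Hypotheses (hU : is_coaction dU) (hV : is_coaction dV) (hW : is_coaction dW).

Definition gam3l (a b c : A) : C :=
  \sw_(a1, a2 <- Delta a) \sw_(b1, b2 <- Delta b)
    (gam g (a1 ⊗ b1) * gam g ((a2 ∙ b2) ⊗ c)).

Definition gam3r (a b c : A) : C :=
  \sw_(b1, b2 <- Delta b) \sw_(c1, c2 <- Delta c)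
    (gam g (b1 ⊗ c1) * gam g (a ⊗ (b2 ∙ c2))).

Lemma twL (m : U -> V -> X) (m' : X -> W -> Z) u v w :
  bilin m -> bilin m' -> colinear2 dU dV dX m ->
  tw dX dW m' (tw dU dV m u v) w =
  \sw_(a, u0 <- dU u) \sw_(b, v0 <- dV v) \sw_(c, w0 <- dW w)
    (gam3l a b c *: m' (m u0 v0) w0).
Proof.
move=> mb mb' mc; have tb := tw_bilin dX dW mb'.
transitivity (\sw_(a, u0 <- dU u) \sw_(b, v0 <- dV v)
  (gam g (a ⊗ b) *: tw dX dW m' (m u0 v0) w)).
  rewrite {2}/tw (lin_sw_out _ _ (bilinl tb w)); apply: eq_sw => a u0.
  rewrite (lin_sw_out _ _ (bilinl tb w)); apply: eq_sw => b v0.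
  by rewrite (linZ (bilinl tb w)).
transitivity (\sw_(a, u0 <- dU u) \sw_(b, v0 <- dV v)
  \sw_(a', u00 <- dU u0) \sw_(b', v00 <- dV v0) \sw_(c, w0 <- dW w)
    ((gam g (a ⊗ b) * gam g ((a' ∙ b') ⊗ c)) *: m' (m u00 v00) w0)).
  apply: eq_sw => a u0; apply: eq_sw => b v0; rewrite /tw mc.
  rewrite sw_sw; last by linq.
  rewrite sw_scale; apply: eq_sw => a' u00; rewrite sw_sw; last by linq.
  rewrite sw_scale; apply: eq_sw => b' v00; rewrite sw_pure; last by linq.
  rewrite sw_scale; apply: eq_sw => c w0; by rewrite scalerA.
rewrite (coact_swap2 (f := fun a a' u00 b b' v00 => \sw_(c, w0 <- dW w)
    ((gam g (a ⊗ b) * gam g ((a' ∙ b') ⊗ c)) *: m' (m u00 v00) w0))) //.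
- apply: eq_sw => a u0; apply: eq_sw => b v0.
  transitivity (\sw_(a1, a2 <- Delta a) \sw_(c, w0 <- dW w)
    \sw_(b1, b2 <- Delta b)
      ((gam g (a1 ⊗ b1) * gam g ((a2 ∙ b2) ⊗ c)) *: m' (m u0 v0) w0)).
    by apply: eq_sw => a1 a2; rewrite sw_exch.
  rewrite sw_exch; apply: eq_sw => c w0.
  rewrite sw_scalel; apply: eq_sw => a1 a2.
  by rewrite sw_scalel.
- by move=> b1 b2 v'; split=> ? ?; linq.
- by move=> a1 a2 u'; split=> ? ?; linq.
Qed.

Lemma twR (m : V -> W -> Y) (m' : U -> Y -> Z) u v w :
  bilin m -> bilin m' -> colinear2 dV dW dY m ->
  tw dU dY m' u (tw dV dW m v w) =
  \sw_(a, u0 <- dU u) \sw_(b, v0 <- dV v) \sw_(c, w0 <- dW w)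
    (gam3r a b c *: m' u0 (m v0 w0)).
Proof.
move=> mb mb' mc; have tb := tw_bilin dU dY mb'.
transitivity (\sw_(b, v0 <- dV v) \sw_(c, w0 <- dW w)
  (gam g (b ⊗ c) *: tw dU dY m' u (m v0 w0))).
  rewrite {2}/tw (lin_sw_out _ _ (bilinr tb u)); apply: eq_sw => b v0.
  rewrite (lin_sw_out _ _ (bilinr tb u)); apply: eq_sw => c w0.
  by rewrite (linZ (bilinr tb u)).
transitivity (\sw_(b, v0 <- dV v) \sw_(c, w0 <- dW w)
  \sw_(b', v00 <- dV v0) \sw_(c', w00 <- dW w0) \sw_(a, u0 <- dU u)
    ((gam g (b ⊗ c) * gam g (a ⊗ (b' ∙ c'))) *: m' u0 (m v00 w00))).
  apply: eq_sw => b v0; apply: eq_sw => c w0; rewrite /tw.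
  transitivity (gam g (b ⊗ c) *: \sw_(a, u0 <- dU u)
     \sw_(b', v00 <- dV v0) \sw_(c', w00 <- dW w0)
     (gam g (a ⊗ (b' ∙ c')) *: m' u0 (m v00 w00))).
    congr (_ *: _); apply: eq_sw => a u0; rewrite mc.
    rewrite sw_sw; last by linq.
    apply: eq_sw => b' v00; rewrite sw_sw; last by linq.
    by apply: eq_sw => c' w00; rewrite sw_pure //; linq.
  rewrite sw_exch sw_scale; apply: eq_sw => b' v00.
  rewrite sw_exch sw_scale; apply: eq_sw => c' w00.
  by rewrite sw_scale; apply: eq_sw => a u0; rewrite scalerA.
rewrite (coact_swap2 (f := fun b b' v00 c c' w00 => \sw_(a, u0 <- dU u)
    ((gam g (b ⊗ c) * gam g (a ⊗ (b' ∙ c'))) *: m' u0 (m v00 w00)))) //.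
- rewrite [RHS]sw_exch; apply: eq_sw => b v0.
  rewrite [RHS]sw_exch; apply: eq_sw => c w0.
  transitivity (\sw_(b1, b2 <- Delta b) \sw_(a, u0 <- dU u)
    \sw_(c1, c2 <- Delta c)
      ((gam g (b1 ⊗ c1) * gam g (a ⊗ (b2 ∙ c2))) *: m' u0 (m v0 w0))).
    by apply: eq_sw => b1 b2; rewrite sw_exch.
  rewrite sw_exch; apply: eq_sw => a u0.
  rewrite sw_scalel; apply: eq_sw => b1 b2.
  by rewrite sw_scalel.
- by move=> ? ? ?; split=> ? ?; linq.
- by move=> ? ? ?; split=> ? ?; linq.
Qed.

Lemma tw_assoc (m : U -> V -> X) (m' : X -> W -> Z) (n : V -> W -> Y)
    (n' : U -> Y -> Z) :
  bilin m -> bilin m' -> bilin n -> bilin n' ->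
  colinear2 dU dV dX m -> colinear2 dV dW dY n ->
  (forall u v w, m' (m u v) w = n' u (n v w)) ->
  forall u v w, tw dX dW m' (tw dU dV m u v) w = tw dU dY n' u (tw dV dW n v w).
Proof.
move=> mb mb' nb nb' mc nc mn u v w; rewrite twL // twR //.
apply: eq_sw => a u0; apply: eq_sw => b v0; apply: eq_sw => c w0.
by rewrite mn /gam3l gam_cocycle.
Qed.

End Tw.

Lemma tw_unitl (U V Z : lmodType C) (dU : {linear U -> tensC A U})
    (dV : {linear V -> tensC A V}) (m : U -> V -> Z) u v :
  is_coaction dV -> bilin m -> dU u = aone ⊗ u -> tw dU dV m u v = m u v.
Proof.
move=> hV mb du; rewrite /tw du sw_pure; last by linq.
under eq_sw do rewrite gam_unitl.
by rewrite (coact_counit (f := m u)) //; apply: (bilinr mb).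
Qed.

Lemma tw_unitr (U V Z : lmodType C) (dU : {linear U -> tensC A U})
    (dV : {linear V -> tensC A V}) (m : U -> V -> Z) u v :
  is_coaction dU -> bilin m -> dV v = aone ⊗ v -> tw dU dV m u v = m u v.
Proof.
move=> hU mb dv; rewrite /tw dv.
transitivity (\sw_(a, u0 <- dU u) (eps a *: m u0 v)).
  by apply: eq_sw => a u0; rewrite sw_pure ?gam_unitr //; linq.
by rewrite (coact_counit (f := m^~ v)) //; apply: (bilinl mb).
Qed.
End Cocycle.

Section TensorB.
Variables (C : numClosedFieldType) (B : algebra C) (E F : bimodule B).

Definition tensB : lmodType C := tens (@ract C B E) (@lact C B F).
Definition tpureB (e : E) (f : F) : tensB := tpure (@ract C B E) (@lact C B F) e f.

Definition tensB_lact (b : B) (t : tensB) : tensB :=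
  \sw_(e, f <- t) tpureB (b ▷ e) f.
Definition tensB_ract (b : B) (t : tensB) : tensB :=
  \sw_(e, f <- t) tpureB e (f ◁ b).

Lemma tensB_lact_bal b : balanced (@ract C B E) (@lact C B F)
  (fun e f => tpureB (b ▷ e) f).
Proof.
apply: bilin_bal => [|k e f]; first by rewrite /tpureB; linq.
by rewrite /tpureB -lractA tpureK.
Qed.
Lemma tensB_ract_bal b : balanced (@ract C B E) (@lact C B F)
  (fun e f => tpureB e (f ◁ b)).
Proof.
apply: bilin_bal => [|k e f]; first by rewrite /tpureB; linq.
by rewrite /tpureB lractA tpureK.
Qed.

Lemma tensB_lactE b e f : tensB_lact b (tpureB e f) = tpureB (b ▷ e) f.
Proof. by rewrite /tensB_lact (tlift_pure _ _ (tensB_lact_bal b)). Qed.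
Lemma tensB_ractE b e f : tensB_ract b (tpureB e f) = tpureB e (f ◁ b).
Proof. by rewrite /tensB_ract (tlift_pure _ _ (tensB_ract_bal b)). Qed.

Lemma tensB_lact_lin b : lin (tensB_lact b).
Proof.
apply: tlift_lin; first exact: tensB_lact_bal.
by move=> f; rewrite /tpureB; linq.
Qed.
Lemma tensB_ract_lin b : lin (tensB_ract b).
Proof.
apply: tlift_lin; first exact: tensB_ract_bal.
by move=> f; rewrite /tpureB; linq.
Qed.
HB.instance Definition _ b :=
  GRing.isLinear.Build C tensB tensB *:%R (tensB_lact b) (tensB_lact_lin b).
HB.instance Definition _ b :=
  GRing.isLinear.Build C tensB tensB *:%R (tensB_ract b) (tensB_ract_lin b).

Lemma tensB_lact_linb t : lin (fun b => tensB_lact b t).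
Proof. by rewrite /tensB_lact /tpureB; linq. Qed.
Lemma tensB_ract_linb t : lin (fun b => tensB_ract b t).
Proof. by rewrite /tensB_ract /tpureB; linq. Qed.

Lemma tensB_ext (Z : lmodType C) (f g : tensB -> Z) : lin f -> lin g ->
  (forall m n, f (tpureB m n) = g (tpureB m n)) -> f =1 g.
Proof. exact: tens_ext. Qed.

Lemma tensB_lact1 t : tensB_lact aone t = t.
Proof.
apply: (@tensB_ext _ (tensB_lact aone) (fun t => t)) => //.
- exact: tensB_lact_lin.
- by move=> e f; rewrite tensB_lactE lact1.
Qed.
Lemma tensB_ract1 t : tensB_ract aone t = t.
Proof.
apply: (@tensB_ext _ (tensB_ract aone) (fun t => t)) => //.
- exact: tensB_ract_lin.
- by move=> e f; rewrite tensB_ractE ract1.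
Qed.
Lemma tensB_lactM a b t : tensB_lact (a ∙ b) t = tensB_lact a (tensB_lact b t).
Proof.
apply: (@tensB_ext _ _ (fun t => tensB_lact a (tensB_lact b t))).
- exact: tensB_lact_lin.
- by apply: lin_linear; apply: tensB_lact_lin.
- by move=> e f; rewrite !tensB_lactE lactM.
Qed.
Lemma tensB_ractM a b t : tensB_ract (a ∙ b) t = tensB_ract b (tensB_ract a t).
Proof.
apply: (@tensB_ext _ _ (fun t => tensB_ract b (tensB_ract a t))).
- exact: tensB_ract_lin.
- by apply: lin_linear; apply: tensB_ract_lin.
- by move=> e f; rewrite !tensB_ractE ractM.
Qed.
Lemma tensB_lractA a b t :
  tensB_ract b (tensB_lact a t) = tensB_lact a (tensB_ract b t).
Proof.
apply: (@tensB_ext _ (fun t => tensB_ract b (tensB_lact a t))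
                     (fun t => tensB_lact a (tensB_ract b t))).
- by apply: lin_linear; apply: tensB_lact_lin.
- by apply: lin_linear; apply: tensB_ract_lin.
- by move=> e f; rewrite !(tensB_ractE, tensB_lactE).
Qed.

Definition bim_tens : bimodule B := @Bimodule C B tensB
  (fun b => tensB_lact b) (fun b => tensB_ract b) tensB_lact_linb tensB_ract_linb
  tensB_lact1 tensB_ract1 tensB_lactM tensB_ractM tensB_lractA.

End TensorB.
Notation "v ⊗b w" := (tpureB v w) : ring_scope.

Section Regular.
Variables (C : numClosedFieldType) (B : algebra C).

Definition reg_lact (b c : B) : B := b ∙ c.
Definition reg_ract (b c : B) : B := c ∙ b.
HB.instance Definition _ b :=
  GRing.isLinear.Build C B B *:%R (reg_lact b) (amul_linr b).
HB.instance Definition _ b :=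
  GRing.isLinear.Build C B B *:%R (reg_ract b) (amul_linl b).

Definition bim_reg : bimodule B := @Bimodule C B B
  (fun b => reg_lact b) (fun b => reg_ract b)
  (fun m => @amul_linl C B m) (fun m => @amul_linr C B m)
  (@amul1l C B) (@amul1r C B)
  (fun a b m => esym (amulA a b m)) (fun a b m => amulA m a b)
  (fun a b m => esym (amulA a m b)).

End Regular.

Section CovariantBimodules.
Variables (C : numClosedFieldType) (A : hopf_star_algebra C).
Variable B : comodule_star_algebra A.

Record covariant_bimodule := CovariantBimodule {
  cb_bim :> bimodule B;
  cb_coact : {linear cb_bim -> tensC A cb_bim};
  cb_coactP : is_coaction cb_coact;
  cb_coact_act : forall a e b, cb_coact ((a ▷ e) ◁ b) =
    \sw_(a1, a0 <- csa_coact a) \sw_(e1, e0 <- cb_coact e)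
      \sw_(b1, b0 <- csa_coact b) (((a1 ∙ e1) ∙ b1) ⊗ ((a0 ▷ e0) ◁ b0))
}.
Arguments cb_coact {_}.

Lemma cb_coact_lact (E : covariant_bimodule) :
  colinear2 csa_coact cb_coact cb_coact (fun (b : B) (e : E) => b ▷ e).
Proof.
move=> b e; rewrite -[b ▷ e in LHS]ract1 cb_coact_act.
apply: eq_sw => a1 a0; apply: eq_sw => e1 e0.
by rewrite csa_coact_one sw_pure ?amul1r ?ract1 //; linq.
Qed.

Lemma cb_coact_ract (E : covariant_bimodule) :
  colinear2 cb_coact csa_coact cb_coact (fun (e : E) (b : B) => e ◁ b).
Proof.
move=> e b; rewrite -[e in LHS]lact1 cb_coact_act csa_coact_one.
rewrite sw_pure; last by linq.
apply: eq_sw => e1 e0; apply: eq_sw => b1 b0.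
by rewrite amul1l lact1.
Qed.

Lemma bilin_lact (E : bimodule B) : bilin (fun (b : B) (e : E) => b ▷ e).
Proof. by linq. Qed.
Lemma bilin_ract (E : bimodule B) : bilin (fun (e : E) (b : B) => e ◁ b).
Proof. by linq. Qed.
Lemma bilin_amul (B' : algebra C) : bilin (@amul C B').
Proof. by linq. Qed.

Section CoTensor.
Variables E F : covariant_bimodule.

(* the diagonal coaction on E ⊗_B F *)
Definition tensB_coact (t : tensB E F) : tensC A (tensB E F) :=
  \sw_(e, f <- t) \sw_(e1, e0 <- cb_coact e) \sw_(f1, f0 <- cb_coact f)
    ((e1 ∙ f1) ⊗ (e0 ⊗b f0)).

Lemma bilin_pureB (E' F' : bimodule B) : bilin (@tpureB C B E' F').
Proof. by rewrite /tpureB; linq. Qed.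

Lemma tensB_coact_bal : balanced (@ract C B E) (@lact C B F)
  (fun e f => \sw_(e1, e0 <- cb_coact e) \sw_(f1, f0 <- cb_coact f)
    ((e1 ∙ f1) ⊗ (e0 ⊗b f0))).
Proof.
have pb := bilin_pureB E F.
apply: bilin_bal => [|k e f]; first by linq.
rewrite cb_coact_ract sw_sw; last by linq.
apply: eq_sw => e1 e0; rewrite sw_sw; last by linq.
rewrite cb_coact_lact sw_sw; last by linq.
apply: eq_sw => b1 b0; rewrite sw_pure; last by linq.
rewrite sw_sw; last by linq.
apply: eq_sw => f1 f0; rewrite sw_pure; last by linq.
by rewrite amulA /tpureB tpureK.
Qed.

Lemma tensB_coactE : colinear2 cb_coact cb_coact tensB_coact (@tpureB C B E F).
Proof. by move=> e f; rewrite /tensB_coact (tlift_pure _ _ tensB_coact_bal). Qed.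

Lemma tensB_coact_lin : lin tensB_coact.
Proof.
have pb := bilin_pureB E F.
by apply: tlift_lin; [exact: tensB_coact_bal|move=> f; linq].
Qed.
HB.instance Definition _ := GRing.isLinear.Build C (tensB E F)
  (tensC A (tensB E F)) *:%R tensB_coact tensB_coact_lin.

Lemma tensB_coactP : is_coaction tensB_coact.
Proof.
have pb := bilin_pureB E F.
split.
- apply: tensB_ext; [by linq|by linq|move=> e f /=].
    rewrite !tensB_coactE !sw_sw; [|by linq|by linq].
  transitivity (\sw_(e1, e0 <- cb_coact e) \sw_(f1, f0 <- cb_coact f)
     \sw_(e1', e00 <- cb_coact e0) \sw_(f1', f00 <- cb_coact f0)
       ((e1 ∙ f1) ⊗ ((e1' ∙ f1') ⊗ (e00 ⊗b f00)))).
    apply: eq_sw => e1 e0; rewrite sw_sw; last by linq.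
    apply: eq_sw => f1 f0; rewrite sw_pure; last by linq.
    rewrite tensB_coactE (lin_sw_out _ _ (g := fun x => (e1 ∙ f1) ⊗ x)); last by linq.
    apply: eq_sw => e1' e00.
    by rewrite (lin_sw_out _ _ (g := fun x => (e1 ∙ f1) ⊗ x)); last by linq.
  rewrite (coact_swap2 (f := fun e1 e1' e00 f1 f1' f00 =>
    ((e1 ∙ f1) ⊗ ((e1' ∙ f1') ⊗ (e00 ⊗b f00))))); first last.
  - by move=> ? ? ?; split=> ? ?; linq.
  - by move=> ? ? ?; split=> ? ?; linq.
  - exact: cb_coactP.
  - exact: cb_coactP.
  apply: eq_sw => e1 e0; rewrite [RHS]sw_sw; last by linq.
  apply: eq_sw => f1 f0; rewrite [RHS]sw_pure; last by linq.
  rewrite Delta_mul [RHS]sw_sw; last by linq.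
  apply: eq_sw => a1 a2; rewrite [RHS]sw_sw; last by linq.
  by apply: eq_sw => b1 b2; rewrite [RHS]sw_pure //; linq.
- apply: tensB_ext; [by linq|by linq|move=> e f /=].
  rewrite tensB_coactE sw_sw; last by linq.
  transitivity (\sw_(e1, e0 <- cb_coact e) (eps e1 *: (e0 ⊗b f))).
    apply: eq_sw => e1 e0; rewrite sw_sw; last by linq.
    transitivity (\sw_(f1, f0 <- cb_coact f) (eps f1 *: (eps e1 *: (e0 ⊗b f0)))).
      apply: eq_sw => f1 f0; rewrite sw_pure; last by linq.
      by rewrite eps_mul scalerA mulrC.
    rewrite (coact_counit (f := fun f0 => eps e1 *: (e0 ⊗b f0))) //.
    - exact: cb_coactP.
    - by linq.
  rewrite (coact_counit (f := fun e0 => e0 ⊗b f)) //.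
  - exact: cb_coactP.
  - by linq.
Qed.

Lemma tensB_coact_act a t b : tensB_coact (tensB_ract b (tensB_lact a t)) =
    \sw_(a1, a0 <- csa_coact a) \sw_(e1, e0 <- tensB_coact t)
      \sw_(b1, b0 <- csa_coact b)
        (((a1 ∙ e1) ∙ b1) ⊗ tensB_ract b0 (tensB_lact a0 e0)).
Proof.
have pb := bilin_pureB E F.
have lb := @tensB_lact_linb C B E F.
have rb := @tensB_ract_linb C B E F.
pose G1 (a : B) (t : bim_tens E F) : tensB E F := tensB_lact a t.
have G1b : bilin G1 by split=> ?; [apply: lb|apply: tensB_lact_lin].
pose G2 (t : bim_tens E F) (b : B) : tensB E F := tensB_ract b t.
have G2b : bilin G2 by split=> ?; [apply: tensB_ract_lin|apply: rb].
pose R t' := \sw_(a1, a0 <- csa_coact a) \sw_(e1, e0 <- tensB_coact t')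
      \sw_(b1, b0 <- csa_coact b)
        (((a1 ∙ e1) ∙ b1) ⊗ (G2 (G1 a0 e0) b0)).
rewrite -/(R t); move: t.
apply: tensB_ext; [by linq| by rewrite /R; linq|move=> e f].
rewrite tensB_lactE tensB_ractE tensB_coactE /R.
rewrite cb_coact_lact sw_sw; last by linq.
apply: eq_sw => a1 a0; rewrite sw_sw; last by linq.
rewrite tensB_coactE sw_sw; last by linq.
apply: eq_sw => e1 e0; rewrite sw_pure; last by linq.
rewrite cb_coact_ract !sw_sw; [|by linq|by linq].
apply: eq_sw => f1 f0; rewrite sw_sw; last by linq.
rewrite sw_pure; last by linq.
apply: eq_sw => b1 b0; rewrite sw_pure; last by linq.
by rewrite /G1 /G2 tensB_lactE tensB_ractE !amulA.
Qed.

Definition cb_tens : covariant_bimodule :=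
  @CovariantBimodule (bim_tens E F) tensB_coact tensB_coactP tensB_coact_act.

End CoTensor.
End CovariantBimodules.
Arguments cb_coact {C A B _}.

Definition colinear (C : numClosedFieldType) (A : hopf_star_algebra C)
    (V W : lmodType C) (dV : V -> tensC A V) (dW : W -> tensC A W)
    (f : V -> W) : Prop :=
  forall v, dW (f v) = \sw_(a, v0 <- dV v) (a ⊗ f v0).

Section Calculus.
Variables (C : numClosedFieldType) (A : hopf_star_algebra C).
Variable B : comodule_star_algebra A.

Definition cast_form (form : nat -> covariant_bimodule B) k l (e : k = l)
  (w : form k) : form l := ecast n (form n) e w.

(* [form0] is the identification of B with the forms of degree 0.  As the
   degrees are type indices, the identities between forms of propositionally
   equal degrees go through [cast_form]. *)
Record covariant_star_calculus := CovariantStarCalculus {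
  form :> nat -> covariant_bimodule B;
  form0 : {linear B -> form 0%N};
  wedge : forall k l, form k -> form l -> form (k + l)%N;
  diff : forall k, {linear form k -> form k.+1};
  fstar : forall k, form k -> form k;
  form0_bij : bijective form0;
  form0_coact : colinear csa_coact cb_coact form0;
  wedge_linl : forall k l (v : form l), lin (fun w : form k => wedge w v);
  wedge_linr : forall k l (w : form k), lin (fun v : form l => wedge w v);
  wedgeA : forall k l n (u : form k) (v : form l) (w : form n),
    wedge (wedge u v) w = cast_form (addnA k l n) (wedge u (wedge v w));
  wedge_form0 : forall a b, wedge (form0 a) (form0 b) = form0 (a ∙ b);
  wedge_lact : forall k b (w : form k), wedge (form0 b) w = b ▷ w;
  wedge_ract : forall k b (w : form k),
    wedge w (form0 b) = cast_form (esym (addn0 k)) (w ◁ b);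
  diffK : forall k (w : form k), diff k.+1 (diff k w) = 0;
  diff_wedge : forall k l (w : form k) (v : form l),
    diff (k + l)%N (wedge w v) =
      wedge (diff k w) v
      + (-1) ^+ k *: cast_form (addnS k l) (wedge w (diff l v));
  calculus_gen : forall P : forall k, form k -> Prop,
    (forall k, P k 0) ->
    (forall k c (v w : form k), P k v -> P k w -> P k (c *: v + w)) ->
    (forall b, P 0%N (form0 b)) ->
    (forall b, P 1%N (diff 0 (form0 b))) ->
    (forall k l (v : form k) (w : form l), P k v -> P l w -> P (k + l)%N (wedge v w)) ->
    forall k w, P k w;
  wedge_coact : forall k l,
    colinear2 cb_coact cb_coact cb_coact (@wedge k l);
  diff_coact : forall k, colinear cb_coact cb_coact (diff k);
  fstarD : forall k, {morph @fstar k : v w / v + w};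
  fstarZ : forall k (c : C) (w : form k), fstar (c *: w) = c^* *: fstar w;
  fstarK : forall k, involutive (@fstar k);
  fstar_form0 : forall b, fstar (form0 b) = form0 (star b);
  fstar_diff : forall k (w : form k), fstar (diff k w) = diff k (fstar w);
  fstar_wedge : forall k l (w : form k) (v : form l),
    fstar (wedge w v) =
      (-1) ^+ (k * l) *: cast_form (addnC l k) (wedge (fstar v) (fstar w));
  fstar_coact : forall k (w : form k),
    cb_coact (fstar w) = \sw_(a, w0 <- cb_coact w) (star a ⊗ fstar w0)
}.

End Calculus.
Arguments fstar {C A B} _ _ _.

Section Metric.
Variables (C : numClosedFieldType).

Record metric (B : algebra C) (E : bimodule B) := Metric {
  met_g : bim_tens E E;
  met_pair : bimodule_hom (bim_tens E E) (bim_reg B);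
  met_snakel : forall w : E, \sw_(x, y <- met_g) (met_pair (w ⊗b x) ▷ y) = w;
  met_snaker : forall w : E, \sw_(x, y <- met_g) (x ◁ met_pair (y ⊗b w)) = w
}.

Definition covariant_metric (A : hopf_star_algebra C)
    (B : comodule_star_algebra A) (E : covariant_bimodule B) (m : metric E) : Prop :=
  colinear (@tensB_coact C A B E E) csa_coact (met_pair m) /\
  colinear csa_coact (@tensB_coact C A B E E) (fun b => b ▷ met_g m).

Definition real_metric (B : algebra C) (E : bimodule B) (st : E -> E)
    (m : metric E) : Prop :=
  forall s : seq (E * E),
    met_g m = \sum_(p <- s) p.1 ⊗b p.2 ->
    met_g m = \sum_(p <- s) st p.2 ⊗b st p.1.

End Metric.

(* conjugate vector space, with [bar v] for the copy of v; note the scalar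
   multiplication [conjv_scale] *)
Definition conjv (C : numClosedFieldType) (V : lmodType C) : Type := V.

Section Conjugate.
Variables (C : numClosedFieldType) (V : lmodType C).
Definition bar (v : V) : conjv V := v.
Definition unbar (v : conjv V) : V := v.

HB.instance Definition _ := GRing.Zmodule.copy (conjv V) V.

Definition conjv_scale (c : C) (v : conjv V) : conjv V := bar (c^* *: unbar v).

Lemma conjv_scaleA a b v : conjv_scale a (conjv_scale b v) = conjv_scale (a * b) v.
Proof. by rewrite /conjv_scale /unbar /bar scalerA rmorphM. Qed.
Lemma conjv_scale1 : left_id 1 conjv_scale.
Proof. by move=> v; rewrite /conjv_scale rmorph1 scale1r. Qed.
Lemma conjv_scaleDr : right_distributive conjv_scale +%R.
Proof. by move=> c v w; apply: scalerDr. Qed.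
Lemma conjv_scaleDl v : {morph conjv_scale^~ v : a b / a + b}.
Proof. by move=> a b; rewrite /conjv_scale rmorphD; apply: scalerDl. Qed.
HB.instance Definition _ := GRing.Zmodule_isLmodule.Build C (conjv V)
  conjv_scaleA conjv_scale1 conjv_scaleDr conjv_scaleDl.

End Conjugate.

Record lhom (C : numClosedFieldType) (B : algebra C) (E : bimodule B) := LHom {
  lh_fun :> E -> B;
  lh_add : {morph lh_fun : x y / x + y};
  lh_lact : forall b x, lh_fun (b ▷ x) = b ∙ lh_fun x
}.

Lemma lhom_eq (C : numClosedFieldType) (B : algebra C) (E : bimodule B)
  (f h : lhom E) : (forall x, f x = h x) -> f = h.
Proof.
case: f h => [f f1 f2] [h h1 h2] /= /funext fh; rewrite -{}fh in h1 h2 *.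
by congr LHom; apply: Prop_irrelevance.
Qed.

Lemma lhom_lin (C : numClosedFieldType) (B : algebra C) (E : bimodule B)
  (f : lhom E) : lin f.
Proof.
move=> c x y; rewrite lh_add; congr (_ + _).
have -> : c *: x = (c *: (aone : B)) ▷ x.
  by rewrite (linZ (@lact_lin C B E x)) lact1.
by rewrite lh_lact (linZ (amul_linl _)) amul1l.
Qed.

Section HermitianOfMetric.
Variables (C : numClosedFieldType) (B : algebra C) (E : bimodule B).
Variables (st : E -> E) (m : metric E).

Definition herm_fun (w : conjv E) (v : E) : B := met_pair m (v ⊗b st (unbar w)).

Lemma herm_add w : {morph herm_fun w : x y / x + y}.
Proof. by move=> x y; rewrite /herm_fun /tpureB tpureDl linearD. Qed.
Lemma herm_lact w b x : herm_fun w (b ▷ x) = b ∙ herm_fun w x.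
Proof. by rewrite /herm_fun -tensB_lactE (bh_lact (met_pair m)). Qed.

Definition herm_of_metric (w : conjv E) : lhom E :=
  LHom (herm_add w) (@herm_lact w).

End HermitianOfMetric.

Section TwColinear.
Variables (C : numClosedFieldType) (A : hopf_star_algebra C) (g : cocycle A).
Variables U V W Z : lmodType C.
Variables (dU : {linear U -> tensC A U}) (dV : {linear V -> tensC A V}).
Variables (dW : {linear W -> tensC A W}).

Lemma eq_tw (m m' : U -> V -> Z) u v :
  (forall u v, m u v = m' u v) -> tw g dU dV m u v = tw g dU dV m' u v.
Proof. by move=> e; apply: eq_sw => a u0; apply: eq_sw => b v0; rewrite e. Qed.

Lemma tw_out (m : U -> V -> W) (f : {linear W -> Z}) u v :
  f (tw g dU dV m u v) = tw g dU dV (fun u v => f (m u v)) u v.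
Proof.
have fl : lin f by move=> c x y; rewrite linearP.
rewrite /tw (lin_sw_out _ _ fl); apply: eq_sw => a u0.
by rewrite (lin_sw_out _ _ fl); apply: eq_sw => b v0; rewrite linearZ.
Qed.

Lemma tw_colinr (m : U -> W -> Z) (f : V -> W) u v :
  colinear dV dW f -> bilin m ->
  tw g dU dW m u (f v) = tw g dU dV (fun u v => m u (f v)) u v.
Proof.
move=> fc mb; rewrite /tw; apply: eq_sw => a u0; rewrite fc sw_sw; last by linq.
by apply: eq_sw => b v0; rewrite sw_pure //; linq.
Qed.

Lemma tw_colinl (m : W -> V -> Z) (f : U -> W) u v :
  colinear dU dW f -> bilin m ->
  tw g dW dV m (f u) v = tw g dU dV (fun u v => m (f u) v) u v.
Proof.
move=> fc mb; rewrite /tw fc sw_sw; last by linq.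
by apply: eq_sw => b v0; rewrite sw_pure //; linq.
Qed.

End TwColinear.


Section Deformation.
Variables (C : numClosedFieldType) (A : hopf_star_algebra C) (g : cocycle A).
Variable B : comodule_star_algebra A.

Definition tw_mul : B -> B -> B := tw g csa_coact csa_coact (@amul C B).

Lemma tw_mul_bilin : bilin tw_mul.
Proof. by apply: tw_bilin; linq. Qed.

Lemma tw_mulA : associative tw_mul.
Proof.
move=> a b c; apply/esym/tw_assoc => //;
  try exact: csa_coactP; try exact: bilin_amul; try exact: csa_coact_mul.
by move=> ? ? ?; rewrite amulA.
Qed.

Lemma tw_mul1l : left_id aone tw_mul.
Proof.
move=> b; rewrite /tw_mul tw_unitl ?amul1l //; first exact: csa_coactP.
- exact: bilin_amul.
- exact: csa_coact_one.
Qed.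
Lemma tw_mul1r : right_id aone tw_mul.
Proof.
move=> b; rewrite /tw_mul tw_unitr ?amul1r //; first exact: csa_coactP.
- exact: bilin_amul.
- exact: csa_coact_one.
Qed.

(* B_γ *)
Definition tw_alg : algebra C := Algebra
  (bilinl tw_mul_bilin) (bilinr tw_mul_bilin) tw_mulA tw_mul1l tw_mul1r.

Section Gamma.
Variable E : covariant_bimodule B.

Definition tw_lact (b : tw_alg) : E -> E :=
  tw g csa_coact cb_coact (fun (b : B) (e : E) => b ▷ e) b.
Definition tw_ract (b : tw_alg) (e : E) : E :=
  tw g cb_coact csa_coact (fun (e : E) (b : B) => e ◁ b) e b.

Lemma tw_lact_bilin : bilin tw_lact.
Proof. by apply: tw_bilin; linq. Qed.
Lemma tw_ract_bilin : bilin (fun e b => tw_ract b e).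
Proof. by apply: tw_bilin; linq. Qed.

HB.instance Definition _ b := GRing.isLinear.Build C E E *:%R (tw_lact b)
  (bilinr tw_lact_bilin b).
HB.instance Definition _ b := GRing.isLinear.Build C E E *:%R (tw_ract b)
  (bilinl tw_ract_bilin b).

Lemma tw_lact1 e : tw_lact aone e = e.
Proof.
rewrite /tw_lact tw_unitl ?lact1 //; first exact: cb_coactP.
- exact: bilin_lact.
- exact: csa_coact_one.
Qed.
Lemma tw_ract1 e : tw_ract aone e = e.
Proof.
rewrite /tw_ract tw_unitr ?ract1 //; first exact: cb_coactP.
- exact: bilin_ract.
- exact: csa_coact_one.
Qed.

Lemma tw_lactM a b e : tw_lact (a ∙ b) e = tw_lact a (tw_lact b e).
Proof.
apply: tw_assoc => //; try exact: csa_coactP; try exact: cb_coactP;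
  try exact: bilin_amul; try exact: bilin_lact;
  try exact: csa_coact_mul; try exact: cb_coact_lact.
by move=> ? ? ?; rewrite lactM.
Qed.
Lemma tw_ractM a b e : tw_ract (a ∙ b) e = tw_ract b (tw_ract a e).
Proof.
apply/esym/tw_assoc => //; try exact: csa_coactP; try exact: cb_coactP;
  try exact: bilin_amul; try exact: bilin_ract;
  try exact: csa_coact_mul; try exact: cb_coact_ract.
by move=> ? ? ?; rewrite ractM.
Qed.
Lemma tw_lractA a b e : tw_ract b (tw_lact a e) = tw_lact a (tw_ract b e).
Proof.
apply: tw_assoc => //; try exact: csa_coactP; try exact: cb_coactP;
  try exact: bilin_lact; try exact: bilin_ract;
  try exact: cb_coact_lact; try exact: cb_coact_ract.
by move=> ? ? ?; rewrite lractA.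
Qed.

(* the underlying bimodule of the image of E under the functor Γ; the coaction
   is that of E *)
Definition tw_bim : bimodule tw_alg := @Bimodule C tw_alg E
  (fun b => tw_lact b) (fun b => tw_ract b)
  (bilinl tw_lact_bilin) (bilinr tw_ract_bilin)
  tw_lact1 tw_ract1 tw_lactM tw_ractM tw_lractA.

End Gamma.

Section Phi.
Variables E F : covariant_bimodule B.

(* φ_{E,F}, the monoidal structure of Γ *)
Definition phi (t : bim_tens (tw_bim E) (tw_bim F)) : tw_bim (cb_tens E F) :=
  \sw_(v, w <- t) tw g cb_coact cb_coact (@tpureB C B E F) v w.

Lemma phi_bal : balanced (@ract C tw_alg (tw_bim E)) (@lact C tw_alg (tw_bim F))
  (tw g cb_coact cb_coact (@tpureB C B E F)).
Proof.
apply: bilin_bal => [|k m n]; first by apply/tw_bilin/bilin_pureB.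
apply: tw_assoc; try exact: csa_coactP; try exact: cb_coactP;
  try exact: bilin_lact; try exact: bilin_ract; try exact: bilin_pureB;
  try exact: cb_coact_lact; try exact: cb_coact_ract.
by move=> ? ? ?; rewrite /tpureB tpureK.
Qed.

Lemma phiE (v : tw_bim E) (w : tw_bim F) :
  phi (v ⊗b w) = tw g cb_coact cb_coact (@tpureB C B E F) v w.
Proof. by rewrite /phi (tlift_pure _ _ phi_bal). Qed.

Lemma phi_lin : lin phi.
Proof.
apply: tlift_lin; first exact: phi_bal.
move=> w; apply: (bilinl (tw_bilin _ _ _ _)); exact: bilin_pureB.
Qed.

HB.instance Definition _ := GRing.isLinear.Build C
  (bim_tens (tw_bim E) (tw_bim F)) (tw_bim (cb_tens E F)) *:%R phi phi_lin.

Lemma phi_lact (b : tw_alg) t : phi (b ▷ t) = b ▷ phi t.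
Proof.
apply: (@tensB_ext _ _ (tw_bim E) (tw_bim F) (tw_bim (cb_tens E F))
  (fun t => phi (b ▷ (t : bim_tens (tw_bim E) (tw_bim F)) : bim_tens (tw_bim E) (tw_bim F)))
  (fun t => b ▷ phi t)).
- by linq; apply: phi_lin.
- by linq; apply: phi_lin.
- move=> v w; rewrite [_ ▷ _ in LHS]tensB_lactE !phiE.
  apply: tw_assoc; try exact: csa_coactP; try exact: cb_coactP;
    try exact: bilin_lact; try exact: bilin_pureB;
    try exact: cb_coact_lact; try exact: tensB_coactE.
  by move=> ? ? ?; rewrite [RHS]tensB_lactE.
Qed.

Lemma phi_ract (b : tw_alg) t : phi (t ◁ b) = phi t ◁ b.
Proof.
apply: (@tensB_ext _ _ (tw_bim E) (tw_bim F) (tw_bim (cb_tens E F))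
  (fun t => phi ((t : bim_tens (tw_bim E) (tw_bim F)) ◁ b : bim_tens (tw_bim E) (tw_bim F)))
  (fun t => phi t ◁ b)).
- by linq; apply: phi_lin.
- by linq; apply: phi_lin.
- move=> v w; rewrite [_ ◁ _ in LHS]tensB_ractE !phiE.
  apply/esym/tw_assoc; try exact: csa_coactP; try exact: cb_coactP;
    try exact: bilin_ract; try exact: bilin_pureB;
    try exact: cb_coact_ract; try exact: tensB_coactE.
  by move=> ? ? ?; rewrite [LHS]tensB_ractE.
Qed.

Definition phi_hom : bimodule_hom (bim_tens (tw_bim E) (tw_bim F))
    (tw_bim (cb_tens E F)) := BimoduleHom phi_lact phi_ract.

(* the inverse of φ, through the convolution inverse of γ *)
Definition phi_inv (t : tw_bim (cb_tens E F)) : bim_tens (tw_bim E) (tw_bim F) :=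
  \sw_(v, w <- (t : bim_tens E F)) \sw_(v1, v0 <- cb_coact v)
    \sw_(w1, w0 <- cb_coact w)
      (gam_inv g (v1 ⊗ w1) *: (@tpureB C tw_alg (tw_bim E) (tw_bim F) v0 w0)).

Lemma phi_invK t : phi (phi_inv t) = t.
Proof.
have pb := bilin_pureB E F.
rewrite -[RHS]tlift_id /phi_inv (lin_sw_out _ _ phi_lin); apply: eq_sw => v w.
rewrite (lin_sw_out _ _ phi_lin).
transitivity (\sw_(v1, v0 <- cb_coact v) \sw_(w1, w0 <- cb_coact w)
  \sw_(v1', v00 <- cb_coact v0) \sw_(w1', w00 <- cb_coact w0)
  ((gam_inv g (v1 ⊗ w1) * gam g (v1' ⊗ w1')) *: (v00 ⊗b w00))).
  apply: eq_sw => v1 v0; rewrite (lin_sw_out _ _ phi_lin).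
  apply: eq_sw => w1 w0; rewrite (linZ phi_lin) phiE /tw sw_scale.
  apply: eq_sw => v1' v00; rewrite sw_scale; apply: eq_sw => w1' w00.
  by rewrite scalerA.
rewrite (coact_swap2 (f := fun v1 v1' v00 w1 w1' w00 =>
  ((gam_inv g (v1 ⊗ w1) * gam g (v1' ⊗ w1')) *: (v00 ⊗b w00)))); first last.
- by move=> ? ? ?; split=> ? ?; linq.
- by move=> ? ? ?; split=> ? ?; linq.
- exact: cb_coactP.
- exact: cb_coactP.
transitivity (\sw_(v1, v0 <- cb_coact v) \sw_(w1, w0 <- cb_coact w)
   (eps v1 *: (eps w1 *: (v0 ⊗b w0)))).
  apply: eq_sw => v1 v0; apply: eq_sw => w1 w0.
  rewrite scalerA -(gam_invl g) sw_scalel; apply: eq_sw => a1 a2.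
  by rewrite sw_scalel.
transitivity (\sw_(v1, v0 <- cb_coact v) (eps v1 *: (v0 ⊗b w))).
  apply: eq_sw => v1 v0; rewrite -sw_scale; congr (_ *: _).
  rewrite (coact_counit (f := fun w0 => v0 ⊗b w0)) //; first exact: cb_coactP.
  by linq.
rewrite (coact_counit (f := fun v0 => v0 ⊗b w)) //; first exact: cb_coactP.
by linq.
Qed.

End Phi.

Section DeformedMetric.
Variables (E : covariant_bimodule B) (m : metric E).
Hypothesis mcov : covariant_metric m.

Definition tw_pair_fun (t : bim_tens (tw_bim E) (tw_bim E)) : bim_reg tw_alg :=
  met_pair m (phi t).

Lemma tw_pair_lin : lin tw_pair_fun.
Proof. by move=> c x y; rewrite /tw_pair_fun phi_lin linearP. Qed.
HB.instance Definition _ := GRing.isLinear.Build C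
  (bim_tens (tw_bim E) (tw_bim E)) (bim_reg tw_alg) *:%R tw_pair_fun tw_pair_lin.

Lemma tw_pair_lact b t : tw_pair_fun (b ▷ t) = b ▷ tw_pair_fun t.
Proof.
have [pc _] := mcov.
rewrite /tw_pair_fun phi_lact; move: (phi t) => x.
rewrite -[RHS]/(tw_mul b (met_pair m x)) -[b ▷ x]/(tw_lact b x).
rewrite /tw_mul (tw_colinr _ _ _ _ pc); last exact: bilin_amul.
by rewrite /tw_lact (tw_out _ _ _ _ (met_pair m)); apply: eq_tw => a y; rewrite bh_lact.
Qed.

Lemma tw_pair_ract b t : tw_pair_fun (t ◁ b) = tw_pair_fun t ◁ b.
Proof.
have [pc _] := mcov.
rewrite /tw_pair_fun phi_ract; move: (phi t) => x.
rewrite -[RHS]/(tw_mul (met_pair m x) b) -[x ◁ b]/(tw_ract b x).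
rewrite /tw_mul (tw_colinl _ _ _ _ pc); last exact: bilin_amul.
by rewrite /tw_ract (tw_out _ _ _ _ (met_pair m)); apply: eq_tw => y a; rewrite bh_ract.
Qed.

Definition tw_pair : bimodule_hom (bim_tens (tw_bim E) (tw_bim E))
  (bim_reg tw_alg) := BimoduleHom tw_pair_lact tw_pair_ract.

Definition tw_g : bim_tens (tw_bim E) (tw_bim E) := @phi_inv E E (met_g m).

Let T := bim_tens E E.
Let dT := @tensB_coact C A B E E.
Let P (x y : E) : B := met_pair m (x ⊗b y).
Let ml (w : E) (t : T) : E := \sw_(x, y <- t) (P w x ▷ y).
Let mr (t : T) (w : E) : E := \sw_(x, y <- t) (x ◁ P y w).

Lemma P_bilin : bilin P.
Proof. by rewrite /P; have pb := bilin_pureB E E; linq. Qed.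

Lemma P_colin : colinear2 cb_coact cb_coact csa_coact P.
Proof.
have pb := bilin_pureB E E; have [pc _] := mcov => x y.
rewrite /P pc tensB_coactE sw_sw; last by linq.
apply: eq_sw => x1 x0; rewrite sw_sw; last by linq.
by apply: eq_sw => y1 y0; rewrite sw_pure //; linq.
Qed.

Lemma ml_bal w : balanced (@ract C B E) (@lact C B E) (fun x y => P w x ▷ y).
Proof.
have Pb := P_bilin; apply: bilin_bal => [|k x y]; first by linq.
by rewrite -lactM /P -(tensB_ractE _ w x) (bh_ract (met_pair m)).
Qed.
Lemma mr_bal w : balanced (@ract C B E) (@lact C B E) (fun x y => x ◁ P y w).
Proof.
have Pb := P_bilin; apply: bilin_bal => [|k x y]; first by linq.
by rewrite -ractM /P -(tensB_lactE _ y w) (bh_lact (met_pair m)).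
Qed.
Lemma mlE w x y : ml w (x ⊗b y) = P w x ▷ y.
Proof. by rewrite /ml (tlift_pure _ _ (ml_bal w)). Qed.
Lemma mrE w x y : mr (x ⊗b y) w = x ◁ P y w.
Proof. by rewrite /mr (tlift_pure _ _ (mr_bal w)). Qed.
Lemma ml_bilin : bilin ml.
Proof.
have Pb := P_bilin; split=> w; rewrite /ml; first by linq.
by apply: tlift_lin; [exact: ml_bal|move=> y; linq].
Qed.
Lemma mr_bilin : bilin mr.
Proof.
have Pb := P_bilin; split=> w; rewrite /mr; last by linq.
by apply: tlift_lin; [exact: mr_bal|move=> y; linq].
Qed.

Lemma tw_snakel (w : tw_bim E) :
  \sw_(x, y <- tw_g) (tw_pair (w ⊗b x) ▷ y) = w.
Proof.
have mlb := tw_bilin g cb_coact (tensB_coact (E:=E) (F:=E)) ml_bilin.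
transitivity (\sw_(x, y <- tw_g) tw g cb_coact dT ml w
    (tw g cb_coact cb_coact (@tpureB C B E E) x y)).
  apply: eq_sw => x y.
  transitivity (tw g csa_coact cb_coact (fun (b : B) (e : E) => b ▷ e)
     (tw g cb_coact cb_coact P w x) y).
    rewrite /= /tw_pair_fun phiE /tw_lact; congr (tw _ _ _ _ _ _).
    exact: (tw_out _ _ _ _ (met_pair m)).
  apply: tw_assoc; try exact: csa_coactP; try exact: cb_coactP;
    try exact: bilin_lact; try exact: bilin_pureB; try exact: P_bilin;
    try exact: ml_bilin; try exact: P_colin; try exact: tensB_coactE.
  by move=> ? ? ?; rewrite mlE.
rewrite -(lin_sw_out _ _ (bilinr mlb w)) -/(phi tw_g) phi_invK.
rewrite tw_unitr; first exact: (met_snakel m w).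
- exact: cb_coactP.
- exact: ml_bilin.
have [_ gc] := mcov.
have := gc aone; rewrite csa_coact_one sw_pure; last by linq.
by rewrite !lact1.
Qed.

Lemma tw_snaker (w : tw_bim E) :
  \sw_(x, y <- tw_g) (x ◁ tw_pair (y ⊗b w)) = w.
Proof.
have mrb := tw_bilin g (tensB_coact (E:=E) (F:=E)) cb_coact mr_bilin.
transitivity (\sw_(x, y <- tw_g) tw g dT cb_coact mr
    (tw g cb_coact cb_coact (@tpureB C B E E) x y) w).
  apply: eq_sw => x y.
  transitivity (tw g cb_coact csa_coact (fun (e : E) (b : B) => e ◁ b) x
     (tw g cb_coact cb_coact P y w)).
    rewrite /= /tw_pair_fun phiE /tw_ract; congr (tw _ _ _ _ _ _).
    exact: (tw_out _ _ _ _ (met_pair m)).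
  apply/esym/tw_assoc; try exact: csa_coactP; try exact: cb_coactP;
    try exact: bilin_ract; try exact: bilin_pureB; try exact: P_bilin;
    try exact: mr_bilin; try exact: P_colin; try exact: tensB_coactE.
  by move=> ? ? ?; rewrite mrE.
rewrite -(lin_sw_out _ _ (bilinl mrb w)) -/(phi tw_g) phi_invK.
rewrite tw_unitl; first exact: (met_snaker m w).
- exact: cb_coactP.
- exact: mr_bilin.
have [_ gc] := mcov.
have := gc aone; rewrite csa_coact_one sw_pure; last by linq.
by rewrite !lact1.
Qed.

Definition tw_metric : metric (tw_bim E) := Metric tw_snakel tw_snaker.

End DeformedMetric.
End Deformation.

Section Antipode.
Variables (C : numClosedFieldType) (A : hopf_star_algebra C).
Let dc := @Delta_coaction C A.

Lemma counitr (Z : lmodType C) (f : A -> Z) (a : A) : lin f ->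
  \sw_(a1, a2 <- Delta a) (eps a2 *: f a1) = f a.
Proof.
move=> fl; rewrite -[in RHS](Delta1r a) (lin_sw_out _ _ fl).
by apply: eq_sw => a1 a2; rewrite (linZ fl).
Qed.

Lemma counitl (Z : lmodType C) (f : A -> Z) (a : A) : lin f ->
  \sw_(a1, a2 <- Delta a) (eps a1 *: f a2) = f a.
Proof. exact: coact_counit. Qed.

Lemma Delta_swap (Z : lmodType C) (f : A -> A -> A -> Z) (a : A) : trilin f ->
  \sw_(a1, a2 <- Delta a) \sw_(a21, a22 <- Delta a2) f a1 a21 a22 =
  \sw_(a1, a2 <- Delta a) \sw_(a11, a12 <- Delta a1) f a11 a12 a2.
Proof. exact: coact_swap. Qed.

Lemma sw_antipl (Z : lmodType C) (f : A -> Z) (a : A) : lin f ->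
  \sw_(a1, a2 <- Delta a) f (antip a1 ∙ a2) = eps a *: f aone.
Proof. by move=> fl; rewrite -(lin_sw_out _ _ fl) antipl (linZ fl). Qed.

Lemma sw_antipr (Z : lmodType C) (f : A -> Z) (a : A) : lin f ->
  \sw_(a1, a2 <- Delta a) f (a1 ∙ antip a2) = eps a *: f aone.
Proof. by move=> fl; rewrite -(lin_sw_out _ _ fl) antipr (linZ fl). Qed.

Lemma antip_mul (a b : A) : antip (a ∙ b) = antip b ∙ antip a.
Proof.
pose F (a1 a2 a3 b1 b2 b3 : A) : A :=
  ((antip b1 ∙ antip a1) ∙ (a2 ∙ b2)) ∙ antip (a3 ∙ b3).
have FA b1 b2 b3 : trilin (fun a1 a2 a3 => F a1 a2 a3 b1 b2 b3).
  by rewrite /F; split=> ? ?; linq.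
have FB a1 a2 a3 : trilin (F a1 a2 a3) by rewrite /F; split=> ? ?; linq.
have H := @coact_swap2 C A A A A Delta Delta F a b dc dc FA FB.
transitivity (\sw_(a1, a2 <- Delta a) \sw_(b1, b2 <- Delta b)
  \sw_(a21, a22 <- Delta a2) \sw_(b21, b22 <- Delta b2) F a1 a21 a22 b1 b21 b22).
  rewrite H.
  transitivity (\sw_(a1, a2 <- Delta a) \sw_(b1, b2 <- Delta b)
      (eps a1 *: (eps b1 *: antip (a2 ∙ b2)))).
    transitivity (\sw_(a1, a2 <- Delta a) (eps a1 *: antip (a2 ∙ b))).
      by rewrite (counitl (f := fun x => antip (x ∙ b))) //; linq.
    apply: eq_sw => a1 a2; rewrite -sw_scale; congr (_ *: _).
    by rewrite (counitl (f := fun x => antip (a2 ∙ x))) //; linq.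
  apply: eq_sw => a1 a2; apply: eq_sw => b1 b2; rewrite sw_exch.
  transitivity (\sw_(b11, b12 <- Delta b1)
      (eps a1 *: ((antip b11 ∙ b12) ∙ antip (a2 ∙ b2)))).
    rewrite -sw_scale; congr (_ *: _).
    rewrite -(lin_sw_out _ _ (g := fun x => x ∙ antip (a2 ∙ b2))); last by linq.
    by rewrite antipl (linZ (amul_linl _)) amul1l.
  apply: eq_sw => b11 b12; apply/esym.
  transitivity (\sw_(a11, a12 <- Delta a1)
    (((antip b11 ∙ (antip a11 ∙ a12)) ∙ b12) ∙ antip (a2 ∙ b2))).
    by rewrite /F; apply: eq_sw => a11 a12; rewrite !amulA.
  rewrite (sw_antipl
    (f := fun x => ((antip b11 ∙ x) ∙ b12) ∙ antip (a2 ∙ b2))); last by linq.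
  by rewrite amul1r.
transitivity (\sw_(a1, a2 <- Delta a) \sw_(b1, b2 <- Delta b)
    (eps a2 *: (eps b2 *: (antip b1 ∙ antip a1)))).
  apply: eq_sw => a1 a2; apply: eq_sw => b1 b2.
  pose G x y := ((antip b1 ∙ antip a1) ∙ (x ∙ antip y)) : A.
  have Gb : bilin G by rewrite /G; linq.
  transitivity (tlift (Delta (a2 ∙ b2)) G).
    rewrite Delta_mul sw_sw //; apply: eq_sw => a21 a22.
    rewrite sw_sw //; apply: eq_sw => b21 b22.
    by rewrite sw_pure // /F /G !amulA.
  rewrite /G -(lin_sw_out _ _ (g := fun x => (antip b1 ∙ antip a1) ∙ x));
    last by linq.
  by rewrite antipr (linZ (amul_linr _)) amul1r eps_mul -scalerA.
transitivity (\sw_(a1, a2 <- Delta a) (eps a2 *: (antip b ∙ antip a1))).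
  apply: eq_sw => a1 a2; rewrite -sw_scale; congr (_ *: _).
  by rewrite (counitr (f := fun x => antip x ∙ antip a1)) //; linq.
by rewrite (counitr (f := fun x => antip b ∙ antip x)) //; linq.
Qed.

Lemma antip_one : antip (aone : A) = aone.
Proof.
have := antipl (aone : A); rewrite Delta_one sw_pure; last by linq.
by rewrite amul1r eps_one scale1r.
Qed.

Lemma antip_comul (Z : lmodType C) (h : A -> A -> Z) (a : A) : bilin h ->
  \sw_(s1, s2 <- Delta (antip a)) h s1 s2 =
  \sw_(a1, a2 <- Delta a) h (antip a2) (antip a1).
Proof.
move=> hb.
pose W (a1 b1 p1 p2 x2 : A) : Z :=
  \sw_(s1, s2 <- Delta (antip x2)) h (antip b1 ∙ (p1 ∙ s1)) (antip a1 ∙ (p2 ∙ s2)).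
have E1 (x a1 b1 : A) : \sw_(x1, x2 <- Delta x) \sw_(p1, p2 <- Delta x1)
    W a1 b1 p1 p2 x2 = eps x *: h (antip b1) (antip a1).
  pose K s t := h (antip b1 ∙ s) (antip a1 ∙ t).
  have Kb : bilin K by rewrite /K; linq.
  transitivity (tlift (Delta (\sw_(x1, x2 <- Delta x) (x1 ∙ antip x2))) K).
    rewrite (lin_sw_out _ _ (g := Delta)); last by linq.
    rewrite sw_sw //; apply: eq_sw => x1 x2; rewrite Delta_mul sw_sw //.
    apply: eq_sw => p1 p2; rewrite sw_sw //; apply: eq_sw => s1 s2.
    by rewrite sw_pure.
  rewrite antipr linearZ Delta_one (linZ (sw_lin Kb)) sw_pure // /K.
  by rewrite !amul1r.
transitivity (\sw_(a1, a2 <- Delta a) \sw_(b1, b2 <- Delta a2)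
   (\sw_(x1, x2 <- Delta b2) \sw_(p1, p2 <- Delta x1) W a1 b1 p1 p2 x2)).
  pose W' (a1 p2 x2 : A) : Z :=
    \sw_(s1, s2 <- Delta (antip x2)) h s1 (antip a1 ∙ (p2 ∙ s2)).
  transitivity (\sw_(a1, a2 <- Delta a) \sw_(p2, x2 <- Delta a2) W' a1 p2 x2).
    rewrite Delta_swap; last by rewrite /W'; split=> ? ?; linq.
    transitivity (\sw_(a1, a2 <- Delta a) (eps a1 *:
       \sw_(s1, s2 <- Delta (antip a2)) h s1 s2)).
      by rewrite (counitl (f := fun x => \sw_(s1, s2 <- Delta (antip x)) h s1 s2)) //; linq.
    apply: eq_sw => a1 a2; rewrite /W' sw_exch sw_scale; apply: eq_sw => s1 s2.
    transitivity (\sw_(u, v <- Delta a1) h s1 ((antip u ∙ v) ∙ s2)).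
      rewrite (sw_antipl (f := fun x => h s1 (x ∙ s2))); last by linq.
      by rewrite amul1l.
    by apply: eq_sw => u v; rewrite amulA.
  apply: eq_sw => a1 a2.
  transitivity (\sw_(b1, b2 <- Delta a2) \sw_(p1, y <- Delta b2)
     \sw_(p2, x2 <- Delta y) W a1 b1 p1 p2 x2); last first.
    apply: eq_sw => b1 b2; rewrite Delta_swap // /W.
    by split=> ? ?; linq.
  rewrite (Delta_swap (f := fun b1 p1 y =>
     \sw_(p2, x2 <- Delta y) W a1 b1 p1 p2 x2)); last first.
    by rewrite /W; split=> ? ?; linq.
  transitivity (\sw_(z, y <- Delta a2) (eps z *:
     \sw_(p2, x2 <- Delta y) W' a1 p2 x2)).
    rewrite (counitl (f := fun y => \sw_(p2, x2 <- Delta y) W' a1 p2 x2)) //.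
    by rewrite /W'; linq.
  apply: eq_sw => z y; rewrite sw_exch sw_scale; apply: eq_sw => p2 x2.
  rewrite /W sw_exch /W' sw_scale; apply: eq_sw => s1 s2.
  transitivity (\sw_(u, v <- Delta z)
      h ((antip u ∙ v) ∙ s1) (antip a1 ∙ (p2 ∙ s2))).
    rewrite (sw_antipl (f := fun x => h (x ∙ s1) (antip a1 ∙ (p2 ∙ s2))));
      last by linq.
    by rewrite amul1l.
  by apply: eq_sw => u v; rewrite -[(antip u ∙ v) ∙ s1]amulA.
apply: eq_sw => a1 a2.
transitivity (\sw_(b1, b2 <- Delta a2) (eps b2 *: h (antip b1) (antip a1))).
  by apply: eq_sw => b1 b2; apply: E1.
by rewrite (counitr (f := fun x => h (antip x) (antip a1))) //; linq.
Qed.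

End Antipode.

Section HermitianMetric.
Variables (C : numClosedFieldType) (A : hopf_star_algebra C).
Variables (B : comodule_star_algebra A) (E : covariant_bimodule B).

(* On conjv E the actions are b (bar e) = bar (e ◁ star b) and
   (bar e) b = bar (star b ▷ e), on lhom E they are (b f)(v) = f (v ◁ b) and
   (f b)(v) = f v ∙ b.  Colinearity of H is stated after evaluation at v, since
   the coaction of f : lhom E is only given by its values f_(-1) ⊗ f_(0)(v). *)
Record covariant_hermitian_metric := CovariantHermitianMetric {
  chm :> conjv E -> lhom E;
  chm_lin : forall v, lin (fun e : conjv E => chm e v);
  chm_lact : forall (b : B) (e : E) v,
    chm (bar (e ◁ star b)) v = chm (bar e) (v ◁ b);
  chm_ract : forall (b : B) (e : E) v,
    chm (bar (star b ▷ e)) v = chm (bar e) v ∙ b;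
  chm_coact : forall (e v : E),
    \sw_(a, e0 <- cb_coact e) (star a ⊗ chm (bar e0) v) =
    \sw_(v1, v0 <- cb_coact v) \sw_(y1, y0 <- csa_coact (chm (bar e) v0))
      ((antip v1 ∙ y1) ⊗ y0);
  chm_bij : bijective chm;
  chm_sym : forall x y : E, star (chm (bar x) y) = chm (bar y) x
}.

Record star_operation (st : E -> E) : Prop := StarOperation {
  so_D : {morph st : v w / v + w};
  so_Z : forall (c : C) w, st (c *: w) = c^* *: st w;
  so_K : involutive st;
  so_lact : forall (b : B) w, st (b ▷ w) = st w ◁ star b;
  so_ract : forall (b : B) w, st (w ◁ b) = star b ▷ st w;
  so_coact : forall w, cb_coact (st w) = \sw_(a, w0 <- cb_coact w) (star a ⊗ st w0)
}.

Variables (st : E -> E) (m : metric E).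
Hypotheses (sto : star_operation st) (mcov : covariant_metric m).
Hypothesis mreal : real_metric st m.

Let P (x y : E) : B := met_pair m (x ⊗b y).
Let Pb : bilin P := P_bilin m.
Let H := herm_of_metric st m.

Lemma Pl b x y : P (b ▷ x) y = b ∙ P x y.
Proof. by rewrite /P -tensB_lactE (bh_lact (met_pair m)). Qed.
Lemma Pr b x y : P x (y ◁ b) = P x y ∙ b.
Proof. by rewrite /P -tensB_ractE (bh_ract (met_pair m)). Qed.
Lemma Pm b x y : P (x ◁ b) y = P x (b ▷ y).
Proof. by rewrite /P /tpureB tpureK. Qed.

Lemma HE e v : H (bar e) v = P v (st e). Proof. by []. Qed.

Lemma H_lin v : lin (fun e : conjv E => H e v).
Proof.
move=> c x y; rewrite -[LHS]/(P v (st (c^* *: (x : E) + y))).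
rewrite (so_D sto) (so_Z sto) conjCK.
exact: (bilinr Pb).
Qed.

Lemma H_coact (e v : E) :
  \sw_(a, e0 <- cb_coact e) (star a ⊗ H (bar e0) v) =
  \sw_(v1, v0 <- cb_coact v) \sw_(y1, y0 <- csa_coact (H (bar e) v0))
      ((antip v1 ∙ y1) ⊗ y0).
Proof.
have cE := cb_coactP E.
have Pc := P_colin mcov.
pose F (a b : A) (x : E) := \sw_(w1, w0 <- cb_coact (st e))
   (((antip a ∙ b) ∙ w1) ⊗ P x w0).
transitivity (\sw_(v1, v0 <- cb_coact v) \sw_(v01, v00 <- cb_coact v0) F v1 v01 v00);
  last first.
  apply: eq_sw => v1 v0; rewrite HE Pc sw_sw; last by linq.
  apply: eq_sw => v01 v00; rewrite sw_sw; last by linq.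
  by apply: eq_sw => w1 w0; rewrite sw_pure ?amulA //; linq.
rewrite (coact_swap _ cE); last by rewrite /F; split=> ? ?; linq.
transitivity (\sw_(v1, v0 <- cb_coact v) (eps v1 *:
   \sw_(w1, w0 <- cb_coact (st e)) (w1 ⊗ P v0 w0))).
  rewrite (coact_counit (f := fun v0 => \sw_(w1, w0 <- cb_coact (st e)) (w1 ⊗ P v0 w0)) _ cE);
    last by linq.
  rewrite (so_coact sto) sw_sw; last by linq.
  by apply: eq_sw => a e0; rewrite sw_pure //; linq.
apply: eq_sw => v1 v0; rewrite /F [RHS]sw_exch sw_scale; apply: eq_sw => w1 w0.
rewrite (sw_antipl (f := fun x => (x ∙ w1) ⊗ P v0 w0)); last by linq.
by rewrite amul1l.
Qed.

Lemma H_bij : bijective H.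
Proof.
exists (fun f : lhom E => bar (st (\sw_(x, y <- met_g m) (x ◁ f y)))) => [e|f].
  by rewrite /H /= -[LHS]/(st (\sw_(x, y <- met_g m) (x ◁ P y (st e))))
    (met_snaker m (st e)) (so_K sto).
apply: lhom_eq => v; rewrite HE (so_K sto) (lin_sw_out _ _ (bilinr Pb v)).
rewrite -[in RHS](met_snakel m v) (lin_sw_out _ _ (lhom_lin f)).
by apply: eq_sw => x y; rewrite Pr lh_lact.
Qed.

Lemma H_sym (x y : E) : star (H (bar x) y) = H (bar y) x.
Proof.
rewrite !HE.
set s := repr (met_g m).
have gs : met_g m = \sum_(p <- s) p.1 ⊗b p.2 by exact: tens_sum.
have gr := mreal gs.
have sl w : w = \sum_(p <- s) P w (st p.2) ▷ st p.1.
  rewrite -[LHS](met_snakel m w) gr (tlift_sum (ml_bal m w)).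
  by apply: eq_bigr => p _; rewrite (tlift_pure _ _ (ml_bal m w)).
have st_sum (F : E * E -> E) : st (\sum_(p <- s) F p) = \sum_(p <- s) st (F p).
  apply: (big_morph st (so_D sto)).
  by have := so_Z sto 0 0; rewrite !scale0r rmorph0 scale0r.
have star_sum (F : E * E -> B) : star (\sum_(p <- s) F p) = \sum_(p <- s) star (F p).
  apply: (big_morph _ (@starD C B)).
  by have := @starZ C B 0 0; rewrite !scale0r rmorph0 scale0r.
transitivity (\sum_(p <- s) P x (st p.2) ∙ star (P y p.1)).
  rewrite [in LHS](sl x) st_sum (lin_bigsum _ _ (bilinr Pb _)) star_sum.
  apply: eq_bigr => p _.
  by rewrite (so_lact sto) (so_K sto) Pr starM starK.
have sy : st y = \sum_(p <- s) st p.2 ◁ star (P y p.1).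
  rewrite -[in LHS](met_snakel m y) /tlift st_sum.
  by apply: eq_bigr => p _; rewrite (so_lact sto).
rewrite [in RHS]sy (lin_bigsum _ _ (bilinr Pb _)).
by apply: eq_bigr => p _; rewrite Pr.
Qed.

Lemma H_lact (b : B) (e : E) v : H (bar (e ◁ star b)) v = H (bar e) (v ◁ b).
Proof. by rewrite !HE (so_ract sto) starK Pm. Qed.
Lemma H_ract (b : B) (e : E) v : H (bar (star b ▷ e)) v = H (bar e) v ∙ b.
Proof. by rewrite !HE (so_lact sto) starK Pr. Qed.

Definition hermitian_metric_of : covariant_hermitian_metric :=
  CovariantHermitianMetric H_lin H_lact H_ract H_coact H_bij H_sym.

End HermitianMetric.

Section CalculusStar.
Variables (C : numClosedFieldType) (A : hopf_star_algebra C).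
Variables (B : comodule_star_algebra A) (Omega : covariant_star_calculus B).

Lemma cast_form_id (form : nat -> covariant_bimodule B) k (e : k = k) (w : form k) :
  cast_form e w = w.
Proof. by rewrite (eq_irrelevance e erefl). Qed.

Lemma cast_form_comp (form : nat -> covariant_bimodule B) k l n (e : k = l)
  (e' : l = n) (w : form k) : cast_form e' (cast_form e w) = cast_form (etrans e e') w.
Proof. by case: n / e'; case: l / e. Qed.

Lemma fstar_lact k (b : B) (w : Omega k) :
  fstar Omega k (b ▷ w) = fstar Omega k w ◁ star b.
Proof.
have := @fstar_wedge _ _ _ Omega 0 k (form0 Omega b) w.
rewrite wedge_lact fstar_form0 wedge_ract cast_form_comp mul0n expr0 scale1r.
by rewrite cast_form_id.
Qed.

Lemma fstar_operation k : star_operation (fstar Omega k).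
Proof.
split.
- exact: fstarD.
- exact: fstarZ.
- exact: fstarK.
- exact: fstar_lact.
- move=> b w; apply: (can_inj (@fstarK _ _ _ Omega k)).
  by rewrite fstarK fstar_lact fstarK starK.
- exact: fstar_coact.
Qed.

End CalculusStar.

Section HermitianDeformation.
Variables (C : numClosedFieldType) (A : hopf_star_algebra C) (g : cocycle A).
Variables (B : comodule_star_algebra A) (E : covariant_bimodule B).

Definition frakS_fun (f : lhom E) (v : tw_bim g E) : tw_alg g B :=
  \sw_(a, v0 <- cb_coact v) \sw_(a1, a2 <- Delta a)
    \sw_(b, f0 <- csa_coact (f v0)) (gam g (a1 ⊗ (antip a2 ∙ b)) *: f0).

Let K (a : A) (y : B) : B := \sw_(a1, a2 <- Delta a)
    \sw_(b, f0 <- csa_coact y) (gam g (a1 ⊗ (antip a2 ∙ b)) *: f0).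

Lemma K_bilin : bilin K.
Proof. by rewrite /K; linq. Qed.

Lemma frakS_add f : {morph frakS_fun f : x y / x + y}.
Proof.
have fl := lhom_lin f.
suff Sl : lin (frakS_fun f : E -> B) by exact: (linD Sl).
have Kb := K_bilin.
have : lin (fun v => \sw_(a, v0 <- cb_coact v) K a (f v0)).
  apply: lin_sw; last by linq.
  by split=> ?; [linq|apply: (lin_lin (bilinr Kb _))].
by [].
Qed.

Lemma frakS_key1 (b : B) (a : A) (y : B) :
  \sw_(b1, b0 <- csa_coact b) K (b1 ∙ a) (b0 ∙ y) =
  \sw_(b1, b0 <- csa_coact b) \sw_(a1, a2 <- Delta a)
    \sw_(y1, y0 <- csa_coact y)
      (gam g ((b1 ∙ a1) ⊗ (antip a2 ∙ y1)) *: (b0 ∙ y0)).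
Proof.
pose G b1 x1 x2 (z : B) : B := \sw_(a1, a2 <- Delta a) \sw_(y1, y0 <- csa_coact y)
  (gam g ((b1 ∙ a1) ⊗ ((antip a2 ∙ (antip x1 ∙ x2)) ∙ y1)) *: (z ∙ y0)).
have cB := csa_coactP B.
transitivity (\sw_(b1, b0 <- csa_coact b) \sw_(b11, b12 <- Delta b1)
   \sw_(b01, b00 <- csa_coact b0) G b11 b12 b01 b00).
  apply: eq_sw => b1 b0; rewrite /K Delta_mul sw_sw; last by linq.
  apply: eq_sw => b11 b12; rewrite sw_sw; last by linq.
  rewrite /G [RHS]sw_exch; apply: eq_sw => a1 a2; rewrite sw_pure; last by linq.
  rewrite csa_coact_mul sw_sw; last by linq.
  apply: eq_sw => b01 b00; rewrite sw_sw; last by linq.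
  apply: eq_sw => y1 y0; rewrite sw_pure; last by linq.
  by rewrite antip_mul !amulA.
rewrite -(coact_swap (f := fun b11 b12 b0 =>
   \sw_(b01, b00 <- csa_coact b0) G b11 b12 b01 b00) _ cB); last first.
  by rewrite /G; split=> ? ?; linq.
apply: eq_sw => b1 b0.
rewrite (coact_swap (f := G b1) _ cB); last by rewrite /G; split=> ? ?; linq.
rewrite -[RHS](coact_counit (f := fun z => \sw_(a1, a2 <- Delta a)
    \sw_(y1, y0 <- csa_coact y)
      (gam g ((b1 ∙ a1) ⊗ (antip a2 ∙ y1)) *: (z ∙ y0))) _ cB); last by linq.
apply: eq_sw => x b00; rewrite /G [LHS]sw_exch [RHS]sw_scale; apply: eq_sw => a1 a2.
rewrite [LHS]sw_exch [RHS]sw_scale; apply: eq_sw => y1 y0.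
rewrite (sw_antipl (f := fun x => gam g ((b1 ∙ a1) ⊗ ((antip a2 ∙ x) ∙ y1)) *: (b00 ∙ y0)));
  last by linq.
by rewrite amul1r.
Qed.

Lemma frakS_key2 (b a u v : A) (w : B) :
  \sw_(x1, x2 <- Delta a) \sw_(p1, p2 <- Delta x1) \sw_(z1, z2 <- Delta x2)
    ((gam g (p1 ⊗ (antip z2 ∙ u)) * gam g (b ⊗ (p2 ∙ (antip z1 ∙ v)))) *: w) =
  \sw_(x1, x2 <- Delta a)
    ((gam g (x1 ⊗ (antip x2 ∙ u)) * gam g (b ⊗ v)) *: w).
Proof.
pose W p1 p2 z1 z2 : B :=
  (gam g (p1 ⊗ (antip z2 ∙ u)) * gam g (b ⊗ (p2 ∙ (antip z1 ∙ v)))) *: w.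
rewrite -(Delta_swap (f := fun p1 p2 x2 => \sw_(z1, z2 <- Delta x2) W p1 p2 z1 z2));
  last by rewrite /W; split=> ? ?; linq.
apply: eq_sw => p1 t.
rewrite (Delta_swap (f := W p1)); last by rewrite /W; split=> ? ?; linq.
rewrite -[RHS](counitl (f := fun z2 => (gam g (p1 ⊗ (antip z2 ∙ u)) * gam g (b ⊗ v)) *: w));
  last by linq.
apply: eq_sw => q z2.
transitivity (\sw_(p2, z1 <- Delta q)
  ((gam g (p1 ⊗ (antip z2 ∙ u)) * gam g (b ⊗ ((p2 ∙ antip z1) ∙ v))) *: w)).
  by apply: eq_sw => p2 z1; rewrite /W amulA.
rewrite (sw_antipr (f := fun x =>
  ((gam g (p1 ⊗ (antip z2 ∙ u)) * gam g (b ⊗ (x ∙ v))) *: w))); last by linq.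
by rewrite amul1l.
Qed.

Lemma frakS_key3 (b a : A) (c y : B) :
  \sw_(x1, x2 <- Delta a) \sw_(y1, y0 <- csa_coact y)
    (gam3r g b x1 (antip x2 ∙ y1) *: (c ∙ y0)) =
  \sw_(x1, x2 <- Delta a) \sw_(y1, y0 <- csa_coact y)
    \sw_(y01, y00 <- csa_coact y0)
    ((gam g (x1 ⊗ (antip x2 ∙ y1)) * gam g (b ⊗ y01)) *: (c ∙ y00)).
Proof.
have cB := csa_coactP B.
transitivity (\sw_(y1, y0 <- csa_coact y) \sw_(y11, y12 <- Delta y1)
  \sw_(x1, x2 <- Delta a) \sw_(p1, p2 <- Delta x1) \sw_(z1, z2 <- Delta x2)
    ((gam g (p1 ⊗ (antip z2 ∙ y11)) * gam g (b ⊗ (p2 ∙ (antip z1 ∙ y12)))) *: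
       (c ∙ y0))).
  rewrite [LHS]sw_exch; apply: eq_sw => y1 y0; rewrite [RHS]sw_exch.
  apply: eq_sw => x1 x2; rewrite /gam3r sw_scalel [RHS]sw_exch.
  apply: eq_sw => p1 p2; rewrite sw_scalel.
  pose G k1 k2 : B := (gam g (p1 ⊗ k1) * gam g (b ⊗ (p2 ∙ k2))) *: (c ∙ y0).
  have Gb : bilin G by rewrite /G; linq.
  rewrite -[LHS]/(tlift (Delta (antip x2 ∙ y1)) G) Delta_mul sw_sw //.
  transitivity (\sw_(s1, s2 <- Delta (antip x2)) \sw_(y11, y12 <- Delta y1)
     G (s1 ∙ y11) (s2 ∙ y12)).
    apply: eq_sw => s1 s2; rewrite sw_sw //; apply: eq_sw => y11 y12.
    by rewrite sw_pure.
  rewrite [LHS]sw_exch; apply: eq_sw => y11 y12.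
  by rewrite (antip_comul (h := fun s1 s2 => G (s1 ∙ y11) (s2 ∙ y12))) //; linq.
transitivity (\sw_(y1, y0 <- csa_coact y) \sw_(y11, y12 <- Delta y1)
  \sw_(x1, x2 <- Delta a)
    ((gam g (x1 ⊗ (antip x2 ∙ y11)) * gam g (b ⊗ y12)) *: (c ∙ y0))).
  by apply: eq_sw => y1 y0; apply: eq_sw => y11 y12; apply: frakS_key2.
rewrite -(coact_swap (f := fun y11 y12 y0 => \sw_(x1, x2 <- Delta a)
    ((gam g (x1 ⊗ (antip x2 ∙ y11)) * gam g (b ⊗ y12)) *: (c ∙ y0))) _ cB);
  last by split=> ? ?; linq.
rewrite [RHS]sw_exch; apply: eq_sw => y1 y0.
by rewrite [RHS]sw_exch; apply: eq_sw.
Qed.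

Lemma tw_mul_lin (b : B) : lin (tw_mul g b).
Proof. exact: (bilinr (tw_mul_bilin g B)). Qed.

Lemma frakS_lact f b v :
  frakS_fun f (b ▷ v) = (b : tw_alg g B) ∙ frakS_fun f v.
Proof.
have Kb := K_bilin; have cB := csa_coactP B; have cE := cb_coactP E.
have fl := lhom_lin f.
pose S (v : E) : B := \sw_(a, v0 <- cb_coact v) K a (f v0).
have Kfb : bilin (fun a (v0 : E) => K a (f v0)).
  by split=> ?; [linq|apply: (lin_lin (bilinr Kb _))].
have Sl : lin S by rewrite /S; apply: lin_sw; last by linq.
pose M (be al : A) (c y : B) : B := \sw_(a1, a2 <- Delta al)
  \sw_(y1, y0 <- csa_coact y) (gam g ((be ∙ a1) ⊗ (antip a2 ∙ y1)) *: (c ∙ y0)).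
have SE (b' : B) (v' : E) : S (b' ▷ v') =
    \sw_(b1, b0 <- csa_coact b') \sw_(a, v0 <- cb_coact v') M b1 a b0 (f v0).
  transitivity (\sw_(b1, b0 <- csa_coact b') \sw_(a, v0 <- cb_coact v')
     K (b1 ∙ a) (b0 ∙ f v0)).
    rewrite /S cb_coact_lact sw_sw //; apply: eq_sw => b1 b0.
    rewrite sw_sw //; apply: eq_sw => a v0; rewrite sw_pure //.
    by rewrite lh_lact.
  rewrite sw_exch [RHS]sw_exch; apply: eq_sw => a v0; exact: frakS_key1.
transitivity (\sw_(b1, b0 <- csa_coact b) \sw_(a, v0 <- cb_coact v)
   \sw_(b01, b00 <- csa_coact b0) \sw_(a', v00 <- cb_coact v0)
     (gam g (b1 ⊗ a) *: M b01 a' b00 (f v00))).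
  rewrite -[LHS]/(S (@tw_lact C A g B E b v)) /tw_lact /tw.
  rewrite (lin_sw_out _ _ Sl); apply: eq_sw => b1 b0.
  rewrite (lin_sw_out _ _ Sl); apply: eq_sw => a v0.
  rewrite (linZ Sl) SE sw_scale; apply: eq_sw => b01 b00.
  by rewrite sw_scale.
rewrite (coact_swap2 (f := fun b1 b01 b00 a a' v00 =>
  gam g (b1 ⊗ a) *: M b01 a' b00 (f v00))); first last.
- by move=> ? ? ?; rewrite /M; split=> ? ?; linq.
- by move=> ? ? ?; rewrite /M; split=> ? ?; linq.
- exact: cE.
- exact: cB.
transitivity (\sw_(b1, b0 <- csa_coact b) \sw_(a, v0 <- cb_coact v)
  \sw_(x1, x2 <- Delta a) \sw_(y1, y0 <- csa_coact (f v0))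
    \sw_(y01, y00 <- csa_coact y0)
    ((gam g (x1 ⊗ (antip x2 ∙ y1)) * gam g (b1 ⊗ y01)) *: (b0 ∙ y00))).
  apply: eq_sw => b1 b0; apply: eq_sw => a v0; rewrite -frakS_key3.
  transitivity (\sw_(b11, b12 <- Delta b1) \sw_(x1, x2 <- Delta a)
    \sw_(x11, x12 <- Delta x1) \sw_(y1, y0 <- csa_coact (f v0))
     ((gam g (b11 ⊗ x11) * gam g ((b12 ∙ x12) ⊗ (antip x2 ∙ y1))) *: (b0 ∙ y0))).
    apply: eq_sw => b11 b12.
    transitivity (\sw_(x1, x2 <- Delta a) \sw_(x21, x22 <- Delta x2)
       \sw_(y1, y0 <- csa_coact (f v0))
     ((gam g (b11 ⊗ x1) * gam g ((b12 ∙ x21) ⊗ (antip x22 ∙ y1))) *: (b0 ∙ y0))).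
      apply: eq_sw => x1 x2; rewrite /M sw_scale; apply: eq_sw => x21 x22.
      by rewrite sw_scale; apply: eq_sw => y1 y0; rewrite scalerA.
    by rewrite Delta_swap //; split=> ? ?; linq.
  rewrite [LHS]sw_exch; apply: eq_sw => x1 x2.
  transitivity (\sw_(b11, b12 <- Delta b1) \sw_(y1, y0 <- csa_coact (f v0))
    \sw_(x11, x12 <- Delta x1)
     ((gam g (b11 ⊗ x11) * gam g ((b12 ∙ x12) ⊗ (antip x2 ∙ y1))) *: (b0 ∙ y0))).
    by apply: eq_sw => b11 b12; rewrite [LHS]sw_exch.
  rewrite [LHS]sw_exch; apply: eq_sw => y1 y0.
  rewrite -[gam3r _ _ _ _](gam_cocycle g) sw_scalel; apply: eq_sw => b11 b12.
  by rewrite sw_scalel.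
have Tl := tw_mul_lin b.
rewrite -[RHS]/(tw_mul g b (S v)) /S (lin_sw_out _ _ Tl) [LHS]sw_exch.
apply: eq_sw => a v0; rewrite /K (lin_sw_out _ _ Tl) [LHS]sw_exch.
apply: eq_sw => x1 x2; rewrite (lin_sw_out _ _ Tl) [LHS]sw_exch.
apply: eq_sw => y1 y0; rewrite (linZ Tl) /tw_mul /tw sw_scale.
apply: eq_sw => b1 b0; rewrite sw_scale; apply: eq_sw => y01 y00.
by rewrite scalerA.
Qed.

Definition frakS (f : lhom E) : lhom (tw_bim g E) :=
  LHom (frakS_add f) (frakS_lact f).

(* the scalar Vbar (star a) acts through the conjugate structure of [conjv E] *)
Definition frakN (e : conjv (tw_bim g E)) : conjv E :=
  \sw_(a, e0 <- cb_coact (unbar e : E)) (Vbar g (star a) *: bar e0).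

Definition tw_star (st : E -> E) (w : tw_bim g E) : tw_bim g E :=
  \sw_(a, w0 <- cb_coact (w : E)) (Vbar g (star a) *: st w0).

(* 𝔖 ∘ Γ(H) ∘ 𝔑; Γ is the identity on underlying maps *)
Definition tw_herm (H : covariant_hermitian_metric E) :
    conjv (tw_bim g E) -> lhom (tw_bim g E) :=
  fun e => frakS (H (frakN e)).

End HermitianDeformation.

Arguments tw_herm {C A} g {B E} H _.

(* Main.v *)
Require Import Defs.
From mathcomp Require Import all_boot all_order all_algebra.
From mathcomp Require Import reals complex.
From mathcomp Require Import boolp.

(** Write ( , ) for the pairing, [u] for the deformed star of [w], and [v] for
    the argument at which both sides are evaluated.

    By definition of the deformed metric, the left-hand side is
    γ(v_(-1) ⊗ u_(-1)) (v_(0), u_(0)).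

    On the right-hand side, 𝔑 multiplies [w_(0)] by the scalar
    Vbar (w_(-1)^* ), acting through the conjugate space; the star of the
    calculus conjugates it back, so H_g (𝔑 (bar w)) is the functional
    v |-> (v, u), for the same [u] ([star_frakN]).  Applying 𝔖 to it gives
    γ(v_(-2) ⊗ S(v_(-1)) (v_(0), u)_(-1)) (v_(0), u)_(0), and colinearity of the
    pairing turns the argument S(v_(-1)) (v_(0), u)_(-1) into
    S(v_(-2)) v_(-1) u_(-1), with (v_(0), u_(0)) as remaining factor.  The
    antipode axiom removes the factors of [v], leaving the left-hand side
    ([frakS_colinear2]). *)

Set Implicit Arguments.
Unset Strict Implicit.
Unset Printing Implicit Defensive.

Import GRing.Theory Num.Theory.

Local Open Scope ring_scope.

Section FrakS.
Variables (C : numClosedFieldType) (A : hopf_star_algebra C) (g : cocycle A).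
Variables (B : comodule_star_algebra A) (E : covariant_bimodule B).

(** In terms of the coaction on functionals, 𝔖(f)(v) is
    γ(v_(-1) ⊗ f_(-1)) f_(0)(v_(0)), the twist of the evaluation.  For
    f = P(-, u) with P colinear, f_(-1) ⊗ f_(0) is u_(-1) ⊗ P(-, u_(0)), so the
    result is the twist of P. *)
Lemma frakS_colinear2 (F : covariant_bimodule B) (P : E -> F -> B) (f : lhom E)
    (u : F) :
  bilin P -> colinear2 cb_coact cb_coact csa_coact P -> (forall v, f v = P v u) ->
  forall v, frakS_fun (g := g) f v = tw g cb_coact cb_coact P v u.
Proof.
move=> Pb Pc fE v; have cE := cb_coactP E.
pose G (a b c : A) (x : E) : B := \sw_(d, u0 <- cb_coact u)
  (gam g (a ⊗ ((antip b ∙ c) ∙ d)) *: P x u0).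
transitivity (\sw_(a, v0 <- cb_coact v) \sw_(a1, a2 <- Delta a)
  \sw_(c, x <- cb_coact v0) G a1 a2 c x).
  apply: eq_sw => a v0; apply: eq_sw => a1 a2.
  rewrite fE Pc sw_sw; last by linq.
  apply: eq_sw => c x; rewrite sw_sw; last by linq.
  by apply: eq_sw => d u0; rewrite sw_pure ?amulA //; linq.
rewrite -(coact_swap (f := fun a b v0 => \sw_(c, x <- cb_coact v0) G a b c x) _ cE);
  last by rewrite /G; split=> ? ?; linq.
apply: eq_sw => a v0.
(* the remaining two coactions are regrouped as a coproduct, S(b_(1)) b_(2) = ε(b) *)
rewrite (coact_swap (f := G a) _ cE); last by rewrite /G; split=> ? ?; linq.
rewrite -[RHS](coact_counit (f := fun x => \sw_(d, u0 <- cb_coact u)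
  (gam g (a ⊗ d) *: P x u0)) _ cE); last by linq.
apply: eq_sw => b x; rewrite /G [LHS]sw_exch [RHS]sw_scale; apply: eq_sw => d u0.
rewrite (sw_antipl (f := fun y => gam g (a ⊗ (y ∙ d)) *: P x u0)); last by linq.
by rewrite amul1l.
Qed.

(** Scalars of [conjv E] act on [E] by their conjugates, and [st] is
    conjugate-linear, so the factor Vbar (w_(-1)^* ) comes out unchanged. *)
Lemma star_frakN (st : E -> E) (w : E) : star_operation st ->
  st (frakN (g := g) w) = tw_star (g := g) st w.
Proof.
move=> sto.
have st0 : st 0 = 0 by have := so_Z sto 0 0; rewrite !scale0r rmorph0 scale0r.
rewrite /frakN /tw_star /tlift.
rewrite -[LHS]/(st (\sum_(p <- repr (cb_coact w)) ((Vbar g (star p.1))^* *: p.2))).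
rewrite (big_morph st (so_D sto) st0); apply: eq_bigr => p _.
by rewrite (so_Z sto) conjCK.
Qed.

End FrakS.

Theorem theorem4p9 (R : realType) (A : hopf_star_algebra R[i])
  (B : comodule_star_algebra A) (Omega : covariant_star_calculus B)
  (m : metric (Omega 1%N)) (mcov : covariant_metric m)
  (mreal : real_metric (fstar Omega 1) m)
  (g : cocycle A) (gu : unitary g) :
  herm_of_metric (tw_star (fstar Omega 1)) (tw_metric g mcov) =
  tw_herm g (hermitian_metric_of (fstar_operation Omega 1) mcov mreal).
Proof.
apply/funext => w; apply: lhom_eq => v.
have Pb := P_bilin m; have Pc := P_colin mcov.
pose u := tw_star (g := g) (fstar Omega 1) w.
apply/esym; rewrite [LHS](frakS_colinear2 (u := u) Pb Pc).
  rewrite /herm_of_metric /herm_fun /= /tw_pair_fun phiE.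
  by rewrite (tw_out _ _ _ _ (met_pair m)).
move=> x; rewrite /u -(star_frakN _ _ (fstar_operation Omega 1)).
exact: HE.
Qed.
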